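(* Let $(X,\|\cdot\|_X)$ be an infinite dimensional Banach space with unit ball $B_X=\{x\in X:\ \|x\|_X\le 1\}$. Suppose that there is a Hilbert space $(H,\|\cdot\|_H)$ and a one-to-one mapping $f:B_X\to H$ such that $f$ is Lipschitz and $f^{-1}:f(B_X)\to X$ is uniformly continuous. Then $X$ admits average metric dimension reduction. In fact, there are a universal constant $C\in(0,\infty)$ and $\alpha=\alpha_X\in[1,\infty)$ (depending only on $X$) such that for any $n\in\mathbb N$ and any $n$-point subset $\mathscr C$ of $X$ there is a linear subspace $F$ of $X$ with $\dim(F)\le C\log n$ and a mapping $g:\mathscr C\to F$ which satisfies $\|g(x)-g(y)\|_X\le\alpha\|x-y\|_X$ for all $x,y\in\mathscr C$ and $$\frac{1}{n^2}\sum_{x\in\mathscr C}\sum_{y\in\mathscr C}\|g(x)-g(y)\|_X\ge\frac{1}{n^2}\sum_{x\in\mathscr C}\sum_{y\in\mathscr C}\|x-y\|_X.$$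
   Context: An infinite dimensional Banach space $(X,\|\cdot\|_X)$ admits average metric dimension reduction if there is $\alpha=\alpha_X\in[1,\infty)$ and, for each $n\in\mathbb N$, an integer $k_n$ with $\lim_{n\to\infty}(\log k_n)/\log n=0$, such that for every $n$-point subset $\mathscr C$ of $X$ there is a linear subspace $F$ of $X$ with $\dim(F)=k_n$ and a mapping $f:\mathscr C\to F$ with $\|f(x)-f(y)\|_X\le\alpha\|x-y\|_X$ for all $x,y\in\mathscr C$, yet $\frac{1}{n^2}\sum_{x,y\in\mathscr C}\|f(x)-f(y)\|_X\ge\frac{1}{n^2}\sum_{x,y\in\mathscr C}\|x-y\|_X$. *)

(* Defs.v *)
From HB Require Import structures.
From mathcomp Require Import all_boot all_order all_algebra.
From mathcomp Require Import finmap.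
From mathcomp Require Import all_classical all_reals all_analysis.

Set Implicit Arguments.
Unset Strict Implicit.
Unset Printing Implicit Defensive.

Import Order.TTheory GRing.Theory Num.Theory.
Import numFieldNormedType.Exports.

Local Open Scope classical_set_scope.
Local Open Scope ring_scope.

Definition subspace_of_dim (R : realType) (X : lmodType R)
    (F : set X) (d : nat) : Prop :=
  exists b : 'I_d -> X,
    (forall c : 'I_d -> R, \sum_i c i *: b i = 0 -> forall i, c i = 0) /\
    F = range (fun c : 'I_d -> R => \sum_i c i *: b i).

Definition infinite_dimensional (R : realType) (X : lmodType R) : Prop :=
  forall d : nat, ~ subspace_of_dim [set: X] d.

Definition unit_ball (R : realType) (X : normedModType R) : set X :=
  [set x | `|x| <= 1].
Arguments unit_ball {R} X.

(* Completeness is carried by the type; [{dot H for idfun}] is the library's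
   type of symmetric positive definite bilinear forms. *)
Definition is_hilbert (R : realType) (H : completeNormedModType R) : Prop :=
  exists ip : {dot H for idfun}, forall x : H, ip x x = `|x| ^+ 2.

(* [g] is total on [X], but only its values on the finite set [A] matter. *)
Definition average_embeds (R : realType) (X : normedModType R)
    (alpha : R) (A : {fset X}) (F : set X) : Prop :=
  exists g : X -> X,
    [/\ forall x, x \in A -> F (g x),
        forall x y, x \in A -> y \in A -> `|g x - g y| <= alpha * `|x - y| &
        (#|` A|%:R ^+ 2)^-1 * (\sum_(x <- A) \sum_(y <- A) `|g x - g y|) >=
        (#|` A|%:R ^+ 2)^-1 * (\sum_(x <- A) \sum_(y <- A) `|x - y|)].

(* Since [ln 0 = 0] in the library, [0 < k n] is required explicitly for the
   logarithm of [k n] to be meaningful. *)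
Definition average_metric_dimension_reduction (R : realType)
    (X : normedModType R) : Prop :=
  exists (alpha : R) (k : nat -> nat),
    [/\ 1 <= alpha,
        forall n, (0 < n)%N -> (0 < k n)%N,
        (fun n => ln (k n)%:R / ln n%:R : R) @ \oo --> (0 : R) &
        forall (n : nat) (A : {fset X}), (0 < n)%N -> #|` A| = n ->
          exists F : set X, subspace_of_dim F (k n) /\ average_embeds alpha A F].

(* Main.v *)
Require Import Defs.
From HB Require Import structures.
From mathcomp Require Import all_boot all_order all_algebra.
From mathcomp Require Import finmap perm zify ring lra.
From mathcomp Require Import all_classical all_reals all_analysis.

Set Implicit Arguments.
Unset Strict Implicit.
Unset Printing Implicit Defensive.

Import Order.TTheory GRing.Theory Num.Theory.
Import numFieldNormedType.Exports.

Local Open Scope classical_set_scope.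
Local Open Scope ring_scope.

(** The theorem combines three facts.

    - Points of a Hilbert space embed, up to a universal distortion, into a
      subspace of [X] of dimension [k] as soon as [k] is a large multiple of the
      logarithm of their number ([hilbert_into_span]).  The Johnson-Lindenstrauss
      lemma ([johnson_lindenstrauss]) moves them to [R^k], and a form of
      Dvoretzky's theorem ([finite_dvoretzky]) moves [R^k] into [X]: a linear map
      that changes lengths by bounded factors in finitely many prescribed
      directions is enough, and every infinite dimensional normed space admits one
      with universal bounds.

    - Points of [X] can be brought into the unit ball without losing more than a
      fixed proportion of their average distance [D].  Some point [p] of the set
      is at average distance at most [D] from the others.  If the points farther
      than [2 D] from [p] account for a fixed proportion of the distances, the
      real-valued function [max 0 (|x - p| - 2 D)] already preserves the average up
      to a constant.  Otherwise the radial retraction to the ball of radius [2 D]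
      around [p] does.

    - On the unit ball, [f] is Lipschitz, and by uniform continuity of its inverse
      it keeps points at distance at least [1/8] apart by some fixed [del].  As
      distances in the ball are at most [2], an average distance bounded below
      survives the passage to the Hilbert space ([average_embedding]).

    Dvoretzky's theorem is needed without any estimate of the dimension from
    which its copy of [R^k] is extracted, which makes an elementary proof
    possible.  The Dvoretzky-Rogers lemma ([dvoretzky_rogers]) provides
    arbitrarily many vectors of norm at least [1/2] whose weak 2-norm is at most
    [1].  Random signed sums built from them have a norm of arbitrarily large
    mean [M] ([exists_stable_family]) while its variance stays at most [2]
    ([sign_mean_variance]).  When [M] is large compared with the number of
    prescribed directions, Chebyshev's inequality replaces the usual Gaussian
    concentration.

    All the randomness consists of finitely many independent signs, handled by
    the averaging operator [sign_mean]. *)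

(** * Averages over random signs *)

Section SignMean.
Context {R : realType}.

(** The expectation of [F (x + \sum_v eps_v v)], where [v] runs over [s] and the
    [eps_v] are independent uniform signs.  The recursion turns statements about
    sign sums into inductions on [s], one sign at a time. *)
Fixpoint sign_mean (V : zmodType) (s : seq V) (F : V -> R) (x : V) : R :=
  if s is v :: s' then (sign_mean s' F (x + v) + sign_mean s' F (x - v)) / 2
  else F x.

Lemma sign_mean_cat (V : zmodType) (s t : seq V) F x :
  sign_mean (s ++ t) F x = sign_mean s (sign_mean t F) x.
Proof. by elim: s x => //= v s IH x; rewrite !IH. Qed.

Lemma sign_mean_map (V W : zmodType) (L : V -> W) s F x :
  {morph L : a b / a - b} ->
  sign_mean (map L s) F (L x) = sign_mean s (F \o L) x.
Proof.
move=> LB; have L0 : L 0 = 0 by rewrite -[in LHS](subrr 0) LB subrr.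
have LD : {morph L : a b / a + b}.
  by move=> a b; rewrite -{1}(opprK b) LB -(sub0r b) LB L0 sub0r opprK.
by elim: s x => //= v s IH x; rewrite -LD -LB !IH.
Qed.

Lemma le_sign_mean (V : zmodType) (s : seq V) F G x :
  (forall y, F y <= G y) -> sign_mean s F x <= sign_mean s G x.
Proof.
move=> FG; elim: s x => //= v s IH x.
by have := IH (x + v); have := IH (x - v); lra.
Qed.

Lemma eq_sign_mean (V : zmodType) (s : seq V) F G x :
  F =1 G -> sign_mean s F x = sign_mean s G x.
Proof. by move=> FG; elim: s x => //= v s IH x; rewrite !IH. Qed.

Lemma sign_mean_cst (V : zmodType) (s : seq V) c x :
  sign_mean s (fun=> c) x = c.
Proof. by elim: s x => //= v s IH x; rewrite !IH; lra. Qed.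

Lemma sign_mean_ge_cst (V : zmodType) (s : seq V) (F : V -> R) (c : R) x :
  (forall y, c <= F y) -> c <= sign_mean s F x.
Proof. by move=> cF; rewrite -[leLHS](sign_mean_cst s c x); apply: le_sign_mean. Qed.

Lemma sign_meanD (V : zmodType) (s : seq V) F G x :
  sign_mean s (fun y => F y + G y) x = sign_mean s F x + sign_mean s G x.
Proof. by elim: s x => //= v s IH x; rewrite !IH; lra. Qed.

Lemma sign_meanZ (V : zmodType) (s : seq V) c F x :
  sign_mean s (fun y => c * F y) x = c * sign_mean s F x.
Proof. by elim: s x => //= v s IH x; rewrite !IH; lra. Qed.

Lemma sign_mean_sum (V : zmodType) (s : seq V) (I : Type) (r : seq I)
    (F : I -> V -> R) x :
  sign_mean s (fun y => \sum_(i <- r) F i y) x =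
  \sum_(i <- r) sign_mean s (F i) x.
Proof.
elim: r => [|i r IH].
  by rewrite big_nil -[RHS](sign_mean_cst s 0 x); apply: eq_sign_mean => y; rewrite big_nil.
rewrite big_cons -IH -sign_meanD; apply: eq_sign_mean => y.
by rewrite big_cons.
Qed.

Lemma sign_mean_translate (V : zmodType) (s : seq V) F x y :
  sign_mean s (fun z => F (z + y)) x = sign_mean s F (x + y).
Proof. by elim: s x => //= v s IH x; rewrite !IH ![_ + y]addrAC. Qed.

Lemma sign_mean_even (V : zmodType) (s : seq V) F x :
  sign_mean s (fun z => F (- z)) x = sign_mean s F (- x).
Proof.
by elim: s x => //= v s IH x; rewrite !IH !opprD opprK addrC.
Qed.

(** First-moment method: every existence result below that comes from a random
    choice goes through this lemma. *)
Lemma sign_mean_witness (V : zmodType) (s : seq V) F x B :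
  sign_mean s F x <= B -> exists y, F y <= B.
Proof.
elim: s x => [|v s IH] x /=; first by exists x.
move=> h; have [/IH //|h1] := leP (sign_mean s F (x + v)) B.
by apply: (IH (x - v)); lra.
Qed.

Lemma sign_mean_jensen (V : zmodType) (s : seq V) (phi : R -> R) F x :
  (forall a b, phi ((a + b) / 2) <= (phi a + phi b) / 2) ->
  phi (sign_mean s F x) <= sign_mean s (phi \o F) x.
Proof.
move=> cphi; elim: s x => //= v s IH x.
have := cphi (sign_mean s F (x + v)) (sign_mean s F (x - v)).
by have := IH (x + v); have := IH (x - v); lra.
Qed.

(** * Sums of signed real numbers *)

Lemma sign_mean_sqr (s : seq R) x :
  sign_mean s (fun t => t ^+ 2) x = x ^+ 2 + \sum_(z <- s) z ^+ 2.
Proof.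
elim: s x => [|v s IH] x /=; first by rewrite big_nil addr0.
by rewrite !IH big_cons; field.
Qed.

Lemma sign_mean_pow4 (s : seq R) x : let q := \sum_(z <- s) z ^+ 2 in
  sign_mean s (fun t => t ^+ 4) x <= x ^+ 4 + 6 * x ^+ 2 * q + 3 * q ^+ 2.
Proof.
elim: s x => [|v s IH] x /=; first by rewrite big_nil; lra.
rewrite big_cons; move: IH => /=; set q := \sum_(z <- s) _ => IH.
have := IH (x + v); have := IH (x - v).
have : 0 <= v ^+ 4 by rewrite exprn_even_ge0.
by nra.
Qed.

(** Khintchine's inequality: the second moment is large and the fourth is
    comparable with its square, so the first moment cannot be small. *)
Lemma khintchine (s : seq R) (r : R) : 0 <= r ->
  \sum_(z <- s) z ^+ 2 = r ^+ 2 -> r / 4 <= sign_mean s (fun t => `|t|) 0.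
Proof.
move=> r0 sr; have [->|rn0] := eqVneq r 0.
  by rewrite mul0r; apply: sign_mean_ge_cst.
have rp : 0 < r by rewrite lt_def rn0.
(* [|t|] lies above [t^2 / r - t^4 / (4 r^3)], and the mean of the latter is
   at least [r - 3 r / 4] by the formulas for the two moments *)
pose P (t : R) := r^-1 * t ^+ 2 + - (r ^- 3 / 4) * t ^+ 4.
apply: (@le_trans _ _ (sign_mean s P 0)).
  rewrite sign_meanD !sign_meanZ sign_mean_sqr sr.
  have := sign_mean_pow4 s 0; rewrite /= sr.
  set m := sign_mean _ _ _ => hm.
  have k0 : 0 <= r ^- 3 / 4 by rewrite divr_ge0 // invr_ge0 exprn_ge0.
  have := ler_wpM2l k0 hm.
  have -> : r ^- 3 / 4 * (0 ^+ 4 + 6 * 0 ^+ 2 * r ^+ 2 + 3 * (r ^+ 2) ^+ 2) =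
      3 * r / 4 by field.
  have -> : r^-1 * (0 ^+ 2 + r ^+ 2) = r by field.
  lra.
apply: le_sign_mean => t; rewrite /P.
have -> : t ^+ 2 = `|t| ^+ 2 by rewrite real_normK ?num_real.
have -> : t ^+ 4 = (`|t| ^+ 2) ^+ 2 by rewrite real_normK ?num_real// -exprM.
have : 0 <= `|t| by [].
set a := `|t| => a0.
have -> : a = r * (a / r) by field.
have : 0 <= a / r by rewrite divr_ge0.
set b := a / r => b0.
have -> : r^-1 * (r * b) ^+ 2 + - (r ^- 3 / 4) * ((r * b) ^+ 2) ^+ 2 =
  r * (b ^+ 2 - b ^+ 4 / 4) by field.
apply: ler_wpM2l => //.
have : 0 <= b * ((5 * b - 6) ^+ 2 * (5 * b + 12)).
  by apply: mulr_ge0 => //; apply: mulr_ge0; [exact: sqr_ge0 | lra].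
have -> : b * ((5 * b - 6) ^+ 2 * (5 * b + 12)) =
  125 * b ^+ 4 - 540 * b ^+ 2 + 432 * b by ring.
by have := sqr_ge0 b; lra.
Qed.

Lemma cosh_le (x : R) : expR x + expR (- x) <= 2 * expR (2 * x ^+ 2).
Proof.
wlog x0 : x / 0 <= x.
  move=> H; have [/H//|x0] := leP 0 x.
  by rewrite -sqrrN addrC -{2}(opprK x); apply: H; lra.
have e1 := expR_ge1Dx (- x); have e2 := expR_ge1Dx x.
have e3 := expR_ge1Dx (2 * x ^+ 2); have e4 := expRxMexpNx_1 x.
(* away from 0 compare exponents, near 0 use [exp x <= 1 / (1 - x)] *)
have [xh|xh] := leP (1 / 2) x.
  have : expR x <= expR (2 * x ^+ 2) by rewrite ler_expR; nra.
  have : expR (- x) <= expR x by rewrite ler_expR; lra.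
  lra.
have p1 := expR_gt0 x; have p2 := expR_gt0 (- x).
have a1 : expR x * (1 - x) <= 1 by nra.
have a2 : expR (- x) * (1 + x) <= 1 by nra.
suff : (expR x + expR (- x)) * (1 - x ^+ 2) <= 2 * (1 + 2 * x ^+ 2) * (1 - x ^+ 2).
  by rewrite ler_pM2r; nra.
have : 0 <= x ^+ 2 <= 1 / 4 by apply/andP; split; nra.
by nra.
Qed.

(** Averaging [exp (l t^2)] over one sign of weight [v] changes the rate [l]
    into [l (1 + 8 l v^2)], because [cosh y <= exp (2 y^2)]; this decreases
    [1 / l] by at most [8 v^2].  After all the signs the rate is therefore at
    most [l / (1 - 8 l q)], with [q] the sum of the squared weights. *)
Lemma sign_mean_exp_sqr (s : seq R) (l x : R) : 0 <= l ->
  let q := \sum_(z <- s) z ^+ 2 in 8 * l * q < 1 ->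
  sign_mean s (fun t => expR (l * t ^+ 2)) x <=
  expR (l / (1 - 8 * l * q) * (x ^+ 2 + q)).
Proof.
move=> l0; elim: s x => [|v s IH] x /=.
  by rewrite big_nil mulr0 subr0 divr1 addr0.
rewrite big_cons; set q := \sum_(z <- s) _ in IH *; move=> hq.
have q0 : 0 <= q by apply: sumr_ge0 => z _; apply: sqr_ge0.
have v0 : 0 <= v ^+ 2 by apply: sqr_ge0.
have hq' : 8 * l * q < 1 by nra.
set m := l / (1 - 8 * l * q) in IH.
have dp : 0 < 1 - 8 * l * q by lra.
have m0 : 0 <= m by rewrite divr_ge0 // ltW.
have lm : l = m * (1 - 8 * l * q) by rewrite /m divfK // gt_eqF.
set M := l / _.
have DM : 0 < 1 - 8 * l * (v ^+ 2 + q) by lra.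
have lM : l = M * (1 - 8 * l * (v ^+ 2 + q)) by rewrite /M divfK // gt_eqF.
have mM : m * (1 + 8 * m * v ^+ 2) <= M.
  rewrite /M ler_pdivlMr //.
  have -> : 1 - 8 * l * (v ^+ 2 + q) = (1 - 8 * l * q) * (1 - 8 * m * v ^+ 2).
    by rewrite /m; field; rewrite gt_eqF.
  have : m * (1 - 8 * l * q) = l by [].
  move=> e; rewrite [leLHS](_ : _ = (m * (1 - 8 * l * q)) *
    (1 - (8 * m * v ^+ 2) ^+ 2)); last by ring.
  by rewrite e; have := sqr_ge0 (8 * m * v ^+ 2); nra.
have := IH (x + v) hq'; have := IH (x - v) hq'.
have -> : m * ((x + v) ^+ 2 + q) = m * (x ^+ 2 + v ^+ 2 + q) + 2 * m * x * v by ring.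
have -> : m * ((x - v) ^+ 2 + q) = m * (x ^+ 2 + v ^+ 2 + q) + - (2 * m * x * v) by ring.
rewrite !(expRD (m * (x ^+ 2 + v ^+ 2 + q))) => h1 h2.
have h3 := cosh_le (2 * m * x * v).
apply: (@le_trans _ _ (expR (m * (x ^+ 2 + v ^+ 2 + q)) * expR (2 * (2 * m * x * v) ^+ 2))).
  by have := expR_gt0 (m * (x ^+ 2 + v ^+ 2 + q)); nra.
rewrite -expRD ler_expR.
have x0 := sqr_ge0 x.
have mm : m <= M by nra.
have -> : m * (x ^+ 2 + v ^+ 2 + q) + 2 * (2 * m * x * v) ^+ 2 =
  m * (1 + 8 * m * v ^+ 2) * x ^+ 2 + m * (v ^+ 2 + q) by ring.
by have := ler_wpM2r x0 mM; have := ler_wpM2r (addr_ge0 v0 q0) mm; lra.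
Qed.

Lemma expR_le_quadratic (t : R) : 0 <= t -> expR (- t) <= 1 - t + t ^+ 2.
Proof.
move=> t0; have [t1|t1] := leP t 1; last first.
  have : expR (- t) <= 1 by rewrite expR_le1; lra.
  by nra.
have e2 := expR_ge1Dx t; have e4 := expRxMexpNx_1 t.
have p2 := expR_gt0 (- t).
have a2 : expR (- t) * (1 + t) <= 1 by nra.
suff : expR (- t) * (1 + t) <= (1 - t + t ^+ 2) * (1 + t) by rewrite ler_pM2r; nra.
by have : 0 <= t ^+ 3; [rewrite exprn_ge0 | nra].
Qed.

(** Lower-tail counterpart of the previous estimate: expand the exponential to
    second order and use the second and fourth moments. *)
Lemma sign_mean_exp_neg (s : seq R) : \sum_(z <- s) z ^+ 2 = 1 ->
  sign_mean s (fun t => expR (- (t ^+ 2 / 6))) 0 <= 11 / 12.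
Proof.
move=> s1.
pose P (t : R) := 1 + (- (1 / 6) * t ^+ 2 + 1 / 36 * t ^+ 4).
apply: (@le_trans _ _ (sign_mean s P 0)).
  apply: le_sign_mean => t; rewrite /P.
  have := expR_le_quadratic (t := t ^+ 2 / 6).
  have -> : (t ^+ 2 / 6) ^+ 2 = 1 / 36 * t ^+ 4 by field.
  by have := sqr_ge0 t; lra.
rewrite !sign_meanD sign_mean_cst !sign_meanZ sign_mean_sqr s1.
by have := sign_mean_pow4 s 0; rewrite /= s1; lra.
Qed.
End SignMean.

(** * Contraction principle for convex functions *)

Section Contraction.
Context {R : realType} {V : lmodType R}.
Implicit Types (F : V -> R) (x u : V).

Definition convex_on_module F := forall a b (t : R), 0 <= t <= 1 ->
  F (t *: a + (1 - t) *: b) <= t * F a + (1 - t) * F b.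

Lemma convex_sign_mean (s : seq V) F :
  convex_on_module F -> convex_on_module (sign_mean s F).
Proof.
move=> cF; elim: s => //= v s IH a b t t01.
have := IH (a + v) (b + v) t t01; have := IH (a - v) (b - v) t t01.
have -> : t *: (a - v) + (1 - t) *: (b - v) = t *: a + (1 - t) *: b - v.
  by rewrite !scalerBr addrACA -opprD -scalerDl subrKC scale1r.
have -> : t *: (a + v) + (1 - t) *: (b + v) = t *: a + (1 - t) *: b + v.
  by rewrite !scalerDr addrACA -scalerDl subrKC scale1r.
by lra.
Qed.

Lemma convex_midpoint F a b : convex_on_module F ->
  F (2^-1 *: (a + b)) <= (F a + F b) / 2.
Proof.
move=> /(_ a b 2^-1) H; rewrite scalerDr.
have {H} : F (2^-1 *: a + (1 - 2^-1) *: b) <= 2^-1 * F a + (1 - 2^-1) * F b.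
  by apply: H; lra.
have -> : 1 - 2^-1 = 2^-1 :> R by lra.
by lra.
Qed.

(** Symmetrised along the direction [u], the function [F] becomes an even convex
    function [phi] of the coefficient, hence nondecreasing in its absolute value.
    Jensen's inequality then replaces the random coefficient by the mean of its
    absolute value, and monotonicity by [c]. *)
Lemma sign_mean_scale_ge (ys : seq R) (c : R) F u x :
  convex_on_module F -> 0 <= c <= sign_mean ys (fun t => `|t|) 0 ->
  (F (x + c *: u) + F (x - c *: u)) / 2 <=
  sign_mean [seq y *: u | y <- ys] F x.
Proof.
move=> cF; set m := sign_mean ys _ _ => /andP[c0 cm].
pose G t := F (t *: u + x); pose phi t := (G t + G (- t)) / 2.
have -> : sign_mean [seq y *: u | y <- ys] F x = sign_mean ys phi 0.
  rewrite -[x in LHS]add0r -sign_mean_translate -(scale0r u).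
  rewrite (sign_mean_map (L := fun t : R => t *: u)); last by move=> a b; rewrite scalerBl.
  rewrite -[LHS]/(sign_mean ys G 0).
  have e : sign_mean ys (fun t => G (- t)) 0 = sign_mean ys G 0.
    by rewrite sign_mean_even oppr0.
  rewrite (eq_sign_mean _ _ (F := phi) (G := fun t => 2^-1 * G t + 2^-1 * G (- t))).
    by rewrite sign_meanD !sign_meanZ e; lra.
  by move=> t; rewrite /phi; lra.
have phi_mid a b : phi ((a + b) / 2) <= (phi a + phi b) / 2.
  have := convex_midpoint (a *: u + x) (b *: u + x) cF.
  have := convex_midpoint ((- a) *: u + x) ((- b) *: u + x) cF.
  have E (p q : R) : 2^-1 *: (p *: u + x + (q *: u + x)) = ((p + q) / 2) *: u + x.
    have -> : p *: u + x + (q *: u + x) = (p + q) *: u + 2 *: x.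
      by rewrite addrACA -scalerDl -mulr2n scaler_nat.
    by rewrite scalerDr !scalerA mulVf ?pnatr_eq0 // scale1r mulrC.
  rewrite !E /phi /G.
  have -> : - ((a + b) / 2) = (- a - b) / 2 by lra.
  by lra.
have phi_abs t : phi `|t| = phi t.
  have [t0|t0] := leP 0 t; first by rewrite ger0_norm.
  by rewrite ltr0_norm // /phi opprK (addrC (G t)).
rewrite -(eq_sign_mean _ _ (F := phi \o (fun t => `|t|))); last exact: phi_abs.
apply: le_trans (sign_mean_jensen ys _ 0 phi_mid); rewrite -/m.
have -> : (F (x + c *: u) + F (x - c *: u)) / 2 = phi c.
  by rewrite /phi /G scaleNr ![x + _]addrC.
have [m0|mn0] := eqVneq m 0.
  by have -> : c = m by lra.
have mp : 0 < m by rewrite lt_def mn0 (le_trans c0).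
pose t := (1 + c / m) / 2.
have t01 : 0 <= t <= 1.
  have : 0 <= c / m <= 1 by rewrite divr_ge0 ?(ltW mp)// ler_pdivrMr // mul1r.
  by rewrite /t; lra.
have E p q : t *: (p *: u + x) + (1 - t) *: (q *: u + x) =
    (t * p + (1 - t) * q) *: u + x.
  rewrite !scalerDr addrACA !scalerA -scalerDl; congr (_ + _).
  by rewrite -scalerDl subrKC scale1r.
have := cF (m *: u + x) ((- m) *: u + x) t t01.
have := cF ((- m) *: u + x) (m *: u + x) t t01.
rewrite !E.
have -> : t * m + (1 - t) * - m = c by rewrite /t; field.
have -> : t * - m + (1 - t) * m = - c by rewrite /t; field.
by rewrite /phi /G; lra.
Qed.

Lemma sign_mean_tensor_ge (us : seq V) (ys : seq R) (c : R) F x :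
  convex_on_module F -> 0 <= c <= sign_mean ys (fun t => `|t|) 0 ->
  sign_mean [seq c *: u | u <- us] F x <=
  sign_mean [seq y *: u | u <- us, y <- ys] F x.
Proof.
move=> cF hc; elim: us x => //= u us IH x.
rewrite sign_mean_cat; apply: (le_trans _ (le_sign_mean _ _ IH)).
exact: sign_mean_scale_ge (convex_sign_mean _ cF) hc.
Qed.
End Contraction.

(** * Variance of the norm of a sign sum *)

Section NormMean.
Context {R : realType} {X : normedModType R}.
Implicit Types (s : seq X) (x v : X).

Lemma convex_norm : convex_on_module (fun x : X => `|x|).
Proof.
move=> a b t /andP[t0 t1]; rewrite (le_trans (ler_normD _ _)) // !normrZ.
by rewrite !ger0_norm // subr_ge0.
Qed.

Lemma norm_le_halfsum x v : `|x| <= (`|x + v| + `|x - v|) / 2.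
Proof.
have := ler_normD (x + v) (x - v).
rewrite addrACA subrr addr0 -mulr2n normrMn; lra.
Qed.

Lemma sign_mean_norm_ge s x : `|x| <= sign_mean s (fun y => `|y|) x.
Proof.
elim: s x => //= v s IH x.
by have := norm_le_halfsum x v; have := IH (x + v); have := IH (x - v); lra.
Qed.

Lemma sign_mean_normZ s (c : R) x : 0 <= c ->
  sign_mean [seq c *: u | u <- s] (fun y => `|y|) (c *: x) =
  c * sign_mean s (fun y => `|y|) x.
Proof.
move=> c0; rewrite (sign_mean_map (L := fun u => c *: u)); last first.
  by move=> a b; rewrite scalerBr.
rewrite -sign_meanZ; apply: eq_sign_mean => y /=.
by rewrite normrZ ger0_norm.
Qed.

(** Weak 2-norm at most one: the operator from [l_2] carrying the unit vectors to
    the elements of [s] is a contraction.  The coefficient is a function of the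
    vector and not of its position in [s]; for lists with repetitions this is a
    weaker condition, still strong enough for the variance bound, and easily
    transferred to tensor products. *)
Definition weakly2_le1 s := forall c : X -> R,
  `|\sum_(v <- s) c v *: v| ^+ 2 <= \sum_(v <- s) c v ^+ 2.

Lemma weakly2_tensor s (ys : seq R) : weakly2_le1 s ->
  \sum_(y <- ys) y ^+ 2 <= 1 ->
  weakly2_le1 [seq y *: v | v <- s, y <- ys].
Proof.
move=> ws y1 c; rewrite !big_allpairs_dep /=.
pose d v := \sum_(y <- ys) c (y *: v) * y.
have -> : \sum_(v <- s) \sum_(y <- ys) c (y *: v) *: (y *: v) =
          \sum_(v <- s) d v *: v.
  apply: eq_bigr => v _; rewrite scaler_suml; apply: eq_bigr => y _.
  by rewrite scalerA.
apply: (le_trans (ws d)); apply: ler_sum => v _.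
(* Cauchy-Schwarz, from the expansion of sum_y (c (y v) - d v * y)^2 *)
have : 0 <= \sum_(y <- ys) (c (y *: v) - d v * y) ^+ 2.
  by apply: sumr_ge0 => y _; apply: sqr_ge0.
have -> : \sum_(y <- ys) (c (y *: v) - d v * y) ^+ 2 =
    \sum_(y <- ys) c (y *: v) ^+ 2 - 2 * d v * d v + d v ^+ 2 * \sum_(y <- ys) y ^+ 2.
  rewrite [in X in - X]/d -mulrA [in X in - X]mulr_sumr !mulr_sumr -sumrB -big_split /=.
  by apply: eq_bigr => y _; rewrite -/(d v); ring.
by have := ler_wpM2l (sqr_ge0 (d v)) y1; lra.
Qed.

(** At a point [x] which is a sign sum involving [v], the positive part of the
    decrease of the norm when the sign of [v] is flipped.  Taking the larger of
    the two possible flips makes it a function of [x] alone, independent of how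
    [x] was obtained. *)
Definition sign_drop x v : R :=
  Num.max 0 (Num.max (`|x| - `|x - v *+ 2|) (`|x| - `|x + v *+ 2|)).

(** Move [x] along all the flips at once, with weights proportional to the drops.
    By convexity the norm decreases at least as much as the weighted average of
    the drops, namely in proportion to the sum [D] of their squares.  The
    displacement, on the other hand, is bounded by the weak 2-norm, in
    proportion to the square root of [D]. *)
Lemma sum_sign_drop_le s x : weakly2_le1 s ->
  \sum_(v <- s) sign_drop x v ^+ 2 <= 4.
Proof.
move=> ws; set D := \sum_(v <- s) _; pose d v := sign_drop x v.
have d0 v : 0 <= d v by rewrite /d /sign_drop le_max lexx.
have D0 : 0 <= D by apply: sumr_ge0 => v _; apply: sqr_ge0.
pose t v : R := if `|x - v *+ 2| <= `|x + v *+ 2| then 1 else -1.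
have dt v : d v * `|x - (t v * 2) *: v| <= d v * (`|x| - d v).
  rewrite /t /d /sign_drop; set p := `|x - v *+ 2|; set q := `|x + v *+ 2|.
  have [pq|qp] := leP p q.
    rewrite mul1r scaler_nat -/p.
    have -> : Num.max (`|x| - p) (`|x| - q) = `|x| - p by apply/max_idPl; lra.
    by have [h|h] := leP (`|x| - p) 0; [rewrite !mul0r | nra].
  rewrite mulN1r scaleNr opprK scaler_nat -/q.
  have -> : Num.max (`|x| - p) (`|x| - q) = `|x| - q by apply/max_idPr; lra.
  by have [h|h] := leP (`|x| - q) 0; [rewrite !mul0r | nra].
pose w := \sum_(v <- s) (d v * t v) *: v; pose S := \sum_(v <- s) d v.
have S0 : 0 <= S by apply: sumr_ge0.
have wD : `|w| ^+ 2 <= D.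
  apply: (le_trans (ws _)); apply: ler_sum => v _.
  by rewrite exprMn /t; case: ifP => _; rewrite ?sqrrN expr1n mulr1.
have e : S *: x - 2 *: w = \sum_(v <- s) d v *: (x - (t v * 2) *: v).
  rewrite scaler_suml scaler_sumr -sumrB; apply: eq_bigr => v _.
  by rewrite scalerBr !scalerA; congr (_ - _ *: _); ring.
have : `|S *: x - 2 *: w| <= S * `|x| - D.
  rewrite e mulr_suml -sumrB (le_trans (ler_norm_sum _ _ _)) //.
  apply: ler_sum => v _; rewrite normrZ ger0_norm //.
  by have := dt v; rewrite /d; lra.
have := lerB_dist (S *: x) (2 *: w); rewrite !normrZ (ger0_norm S0) ger0_norm //.
by have : 0 <= `|w| by []; nra.
Qed.

(** Efron-Stein inequality for the norm: each sign adds the squared influence it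
    has on the mean, controlled by the mean squared drop. *)
Lemma sign_mean_sqr_norm_le s x :
  sign_mean s (fun y => `|y| ^+ 2) x <= (sign_mean s (fun y => `|y|) x) ^+ 2 +
  sign_mean s (fun y => \sum_(v <- s) sign_drop y v ^+ 2) x / 2.
Proof.
elim: s x => [|v s IH] x /=; first by rewrite big_nil; lra.
set f := fun y => \sum_(u <- v :: s) _.
have fE y : f y = sign_drop y v ^+ 2 + \sum_(u <- s) sign_drop y u ^+ 2.
  by rewrite /f big_cons.
rewrite !(eq_sign_mean _ _ fE) !sign_meanD.
have := IH (x + v); have := IH (x - v).
set Mp := sign_mean s (fun y => `|y|) (x + v).
set Mm := sign_mean s (fun y => `|y|) (x - v).
set Dp := sign_mean s (fun y => sign_drop y v ^+ 2) (x + v).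
set Dm := sign_mean s (fun y => sign_drop y v ^+ 2) (x - v).
suff : (Mp - Mm) ^+ 2 <= Dp + Dm by lra.
rewrite /Mp /Mm /Dp /Dm -4!sign_mean_translate -(mulN1r (sign_mean s (fun z => `|z - v|) x)).
rewrite -sign_meanZ -!sign_meanD.
apply: (le_trans (sign_mean_jensen (phi := fun t => t ^+ 2) _ _ _ _)).
  by move=> a b; have := sqr_ge0 (a - b); nra.
apply: le_sign_mean => z /=.
have E1 : z + v - v *+ 2 = z - v by rewrite mulr2n opprD addrA addrK.
have E2 : z - v + v *+ 2 = z + v by rewrite mulr2n addrA subrK.
have [h|h] := leP `|z - v| `|z + v|.
  have : `|z + v| - `|z - v| <= sign_drop (z + v) v.
    by rewrite /sign_drop E1 !le_max lexx !orbT.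
  by have := sqr_ge0 (sign_drop (z - v) v); nra.
have : `|z - v| - `|z + v| <= sign_drop (z - v) v.
  by rewrite /sign_drop E2 !le_max lexx !orbT.
by have := sqr_ge0 (sign_drop (z + v) v); nra.
Qed.

(** The bound depends neither on the number of vectors nor on the mean, so the
    norm concentrates as soon as its mean is large. *)
Lemma sign_mean_variance s x : weakly2_le1 s ->
  sign_mean s (fun y => `|y| ^+ 2) x <=
  (sign_mean s (fun y => `|y|) x) ^+ 2 + 2.
Proof.
move=> ws; apply: (le_trans (sign_mean_sqr_norm_le s x)); rewrite lerD2l.
have : sign_mean s (fun y => \sum_(v <- s) sign_drop y v ^+ 2) x <=
    sign_mean s (fun=> 4) x.
  by apply: le_sign_mean => y; apply: sum_sign_drop_le.
by rewrite sign_mean_cst; lra.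
Qed.
End NormMean.

(** * Linearly independent families in infinite dimension *)

Section LinearlyIndependentFamilies.
Context {R : realType} {X : lmodType R}.

Definition lin_indep d (b : 'I_d -> X) :=
  forall c : 'I_d -> R, \sum_i c i *: b i = 0 -> forall i, c i = 0.

Definition span_of d (b : 'I_d -> X) : set X :=
  range (fun c : 'I_d -> R => \sum_i c i *: b i).

Definition cons_family d (x : X) (b : 'I_d -> X) (i : 'I_d.+1) : X :=
  oapp b x (unlift ord0 i).

Lemma sum_cons_family d (x : X) (b : 'I_d -> X) (c : 'I_d.+1 -> R) :
  \sum_i c i *: cons_family x b i =
  c ord0 *: x + \sum_i c (lift ord0 i) *: b i.
Proof.
rewrite big_ord_recl /cons_family unlift_none /=; congr (_ + _).
by apply: eq_bigr => i _; rewrite liftK.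
Qed.

Lemma lin_indep_cons d (x : X) (b : 'I_d -> X) :
  lin_indep b -> ~ span_of b x -> lin_indep (cons_family x b).
Proof.
move=> ib xb c; rewrite sum_cons_family => c0.
have c00 : c ord0 = 0.
  apply/eqP/negP => /negP cn0; apply: xb.
  exists (fun i => - ((c ord0)^-1 * c (lift ord0 i))) => //.
  move/(congr1 (fun y => (c ord0)^-1 *: y)): c0.
  rewrite scalerDr scaler0 scalerA mulVf // scale1r => /eqP.
  rewrite addr_eq0 => /eqP ->; rewrite scaler_sumr -sumrN.
  by apply: eq_bigr => i _; rewrite scaleNr scalerA.
move: c0; rewrite c00 scale0r add0r => /ib cb i.
by case: (unliftP ord0 i) => [j ->|->].
Qed.

Hypothesis infX : infinite_dimensional X.

Lemma exists_outside_span d (b : 'I_d -> X) : lin_indep b ->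
  exists x, ~ span_of b x.
Proof.
move=> ib; apply: contrapT => /forallNP h; apply: (infX (d := d)).
exists b; split => //; apply/seteqP; split => x // _.
by have /contrapT := h x.
Qed.

(** Subspaces of prescribed dimension: whenever the next vector of [w] adds
    nothing to the span, any vector outside it takes its place. *)
Lemma span_sub_lin_indep d (w : 'I_d -> X) :
  exists2 b : 'I_d -> X, lin_indep b & span_of w `<=` span_of b.
Proof.
elim: d w => [|d IH] w.
  by exists w => // c _ [].
have [b ib wb] := IH (fun i => w (lift ord0 i)).
have [x [xb wx]] : exists x, ~ span_of b x /\
    exists t (c : 'I_d -> R), w ord0 = t *: x + \sum_i c i *: b i.
  have [[c _ wc]|nw] := pselect (span_of b (w ord0)).
    have [x xb] := exists_outside_span ib; exists x; split => //.
    by exists 0, c; rewrite scale0r add0r wc.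
  exists (w ord0); split => //; exists 1, (fun=> 0).
  by rewrite scale1r big1 ?addr0 // => i _; rewrite scale0r.
exists (cons_family x b); first exact: lin_indep_cons.
move=> _ [c _ <-]; have [t [e we]] := wx.
have [e' _ e'E] : span_of b (\sum_i c (lift ord0 i) *: w (lift ord0 i)).
  by apply: wb; exists (fun i => c (lift ord0 i)).
exists (fun i => if unlift ord0 i is Some j then c ord0 * e j + e' j else c ord0 * t) => //.
rewrite sum_cons_family unlift_none big_ord_recl -e'E we scalerDr scalerA -addrA.
congr (_ + _); rewrite scaler_sumr -big_split /=; apply: eq_bigr => i _.
by rewrite liftK scalerDl scalerA.
Qed.

Lemma exists_lin_indep d : exists b : 'I_d -> X, lin_indep b.
Proof. by have [b ib _] := span_sub_lin_indep (fun _ : 'I_d => 0); exists b. Qed.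
End LinearlyIndependentFamilies.

(** * The Dvoretzky-Rogers lemma *)

Section DvoretzkyRogers.
Context {R : realType} {X : normedModType R}.

Section Frame.
Context {N : nat} (b : 'I_N -> X) (ib : lin_indep b).
Implicit Types (a : 'rV[R]_N) (A B : 'M[R]_N).

Definition comb (u : 'rV[R]_N) : X := \sum_j u 0 j *: b j.

Lemma comb_is_linear : linear comb.
Proof.
move=> t u v; rewrite /comb scaler_sumr -big_split /=; apply: eq_bigr => j _.
by rewrite !mxE scalerDl scalerA.
Qed.

HB.instance Definition _ := GRing.isLinear.Build R 'rV[R]_N X _ comb comb_is_linear.

Lemma comb_continuous : continuous comb.
Proof.
move=> u; rewrite /continuous_at.
apply: (@cvg_big _ _ _ _ _ _ _ (nbhs u) _ (fun j (v : 'rV[R]_N) => v 0 j *: b j)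
  (fun j => u 0 j *: b j)) => [|j _]; first exact: add_continuous.
by apply: cvgZr_tmp; apply: coord_continuous.
Qed.

(** The norm of [comb u] attains a positive minimum on the compact unit sphere of
    coordinate vectors; coordinates are thus bounded linear forms. *)
Lemma comb_coord_le : exists2 C : R, 0 <= C &
  forall (u : 'rV[R]_N) j, `|u 0 j| <= C * `|comb u|.
Proof.
pose S : set 'rV[R]_N := [set u | `|u| = 1].
have coord_le (u : 'rV[R]_N) j : `|u 0 j| <= `|u|.
  rewrite (_ : `|u| = mx_norm u) // mx_normrE.
  exact: (le_bigmax _ (fun ij => `|u ij.1 ij.2|) (0, j)).
have normalize (u : 'rV[R]_N) : u != 0 -> S (`|u|^-1 *: u).
  move=> un0; rewrite /S /= normrZ normfV normr_id mulVf //.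
  by rewrite normr_eq0.
have [S0|Sn0] := eqVneq S set0.
  exists 0 => // u j; rewrite mul0r.
  have [->|un0] := eqVneq u 0; first by rewrite mxE normr0.
  by have := normalize u un0; rewrite S0.
have cS : compact S.
  apply: bounded_closed_compact.
    by exists 1; split => // M M1 u /= ->; exact: ltW.
  have -> : S = (fun u => `|u|) @^-1` [set 1] by [].
  by apply: closed_comp => [u _|]; [exact: norm_continuous | exact: closed_eq].
have cf : {within S, continuous (fun u => `|comb u| : R)}.
  apply: continuous_subspaceT => u.
  exact: (continuous_comp (@comb_continuous u) (@norm_continuous _ _ _)).
move/set0P in Sn0; have [c /set_mem cS1 cmin] := EVT_min_rV Sn0 cS cf.
have c0 : 0 < `|comb c|.
  rewrite normr_gt0; apply/negP => /eqP /ib h.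
  have : c = 0 by apply/rowP => j; rewrite mxE; apply: h.
  by move=> c0; move: cS1; rewrite /S /= c0 normr0 => /eqP; rewrite eq_sym oner_eq0.
exists (`|comb c|^-1); first by rewrite invr_ge0.
move=> u j; have [->|un0] := eqVneq u 0; first by rewrite mxE normr0 mulr_ge0 ?invr_ge0.
apply: (le_trans (coord_le u j)); rewrite ler_pdivlMl //.
have := cmin _ (mem_set (normalize u un0)).
rewrite linearZ normrZ normfV normr_id ler_pdivlMl ?normr_gt0 //.
by rewrite mulrC.
Qed.

Definition sumsq (a : 'rV[R]_N) : R := \sum_i a 0 i ^+ 2.
Definition enorm (a : 'rV[R]_N) : R := Num.sqrt (sumsq a).

Lemma sumsq_ge0 a : 0 <= sumsq a.
Proof. by apply: sumr_ge0 => i _; apply: sqr_ge0. Qed.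

Lemma sumsq_mul a : sumsq a = (a *m a^T) 0 0.
Proof. by rewrite mxE; apply: eq_bigr => i _; rewrite mxE expr2. Qed.

Lemma enorm_coord_le a j : `|a 0 j| <= enorm a.
Proof.
rewrite -sqrtr_sqr ler_sqrt ?sumsq_ge0 // /sumsq (bigD1 j) //= lerDl.
by apply: sumr_ge0 => i _; apply: sqr_ge0.
Qed.

Lemma enormZ t a : enorm (t *: a) = `|t| * enorm a.
Proof.
rewrite /enorm -sqrtr_sqr -sqrtrM ?sqr_ge0 //; congr Num.sqrt.
by rewrite /sumsq mulr_sumr; apply: eq_bigr => i _; rewrite mxE exprMn.
Qed.

(** The ellipsoid which is the image of the Euclidean unit ball under
    [a |-> comb (a *m A)] is contained in the unit ball of [X]; its volume is
    proportional to [|\det A|]. *)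
Definition contractive (A : 'M[R]_N) :=
  forall a : 'rV[R]_N, `|comb (a *m A)| <= enorm a.

(** The supremum of the volume is approached within a factor 4/3, less than the
    factor 3/2 gained by the competitor below. *)
Definition det_nearly_maximal (A : 'M[R]_N) := 0 < `|\det A| /\
  forall B, contractive B -> `|\det B| <= 4 / 3 * `|\det A|.

Lemma exists_det_nearly_maximal :
  exists2 A, contractive A & det_nearly_maximal A.
Proof.
have [C C0 hC] := comb_coord_le.
pose E : set R := [set `|\det A| | A in contractive].
pose S : R := \sum_j `|b j|.
have S0 : 0 <= S by apply: sumr_ge0.
(* small multiples of the identity are contractive, so the supremum is positive *)
pose t := (1 + S)^-1.
have t0 : 0 < t by rewrite invr_gt0; lra.
have Et : E (t ^+ N).
  exists t%:M; last by rewrite det_scalar ger0_norm // exprn_ge0 ?ltW.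
  move=> a; rewrite mul_mx_scalar linearZ /= normrZ (gtr0_norm t0) ler_pdivrMl; last lra.
  apply: (@le_trans _ _ (enorm a * S)); last by rewrite mulrDl mul1r mulrC lerDr sqrtr_ge0.
  rewrite /comb (le_trans (ler_norm_sum _ _ _)) // mulr_sumr; apply: ler_sum => j _.
  by rewrite normrZ ler_wpM2r ?enorm_coord_le.
have ubE : has_ubound E.
  exists (\sum_(s : 'S_N) \prod_(i < N) C) => _ [A cA <-].
  rewrite (le_trans (ler_norm_sum _ _ _)) //; apply: ler_sum => s _.
  rewrite normrM normrX normrN1 expr1n mul1r normr_prod.
  apply: ler_prod => i _; rewrite normr_ge0 /=.
  have := hC (row i A) (s i); rewrite mxE => /le_trans; apply.
  rewrite -[leRHS]mulr1; apply: ler_wpM2l => //.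
  rewrite rowE; apply: (le_trans (cA _)).
  rewrite /enorm /sumsq (bigD1 i) //= mxE !eqxx expr1n big1 ?addr0 ?sqrtr1 //.
  by move=> k /negbTE ki; rewrite mxE ki andbF expr0n.
have sE : has_sup E.
  by split=> //; exists (t ^+ N).
have tS : t ^+ N <= sup E by apply: ub_le_sup.
have S4 : 0 < sup E / 4 by rewrite divr_gt0 // (lt_le_trans _ tS) // exprn_gt0.
have [_ [A cA <-] hA] := sup_adherent S4 sE.
exists A => //; split; first by lra.
move=> B cB; have : `|\det B| <= sup E by apply: ub_le_sup => //; exists B.
by lra.
Qed.

(** Shrinking the first [j] rows by 1/2 and stretching the others by 3/2
    multiplies the determinant by at least 3/2 when [4 j < N].  If all unit
    combinations of the last rows had norm at most 1/2, the result would still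
    be contractive, against near-maximality. *)
Lemma exists_large_tail_vector A (j : nat) : contractive A ->
  det_nearly_maximal A -> (4 * j < N)%N ->
  exists a : 'rV[R]_N, [/\ sumsq a = 1, forall i : 'I_N, (i < j)%N -> a 0 i = 0
    & 1 / 2 <= `|comb (a *m A)| ].
Proof.
move=> cA [dA mA] jN; apply: contrapT => H.
have small a : (forall i : 'I_N, (i < j)%N -> a 0 i = 0) ->
    `|comb (a *m A)| <= enorm a / 2.
  move=> a0; rewrite leNgt; apply/negP => h; apply: H.
  have ep : 0 < enorm a.
    rewrite lt_def sqrtr_ge0 andbT; apply/negP => /eqP e0.
    by have := cA a; rewrite e0 in h *; lra.
  exists ((enorm a)^-1 *: a); split.
  - have : enorm ((enorm a)^-1 *: a) = 1.
      by rewrite enormZ normfV gtr0_norm // mulVf ?gt_eqF.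
    by move=> e1; rewrite -[LHS]sqr_sqrtr ?sumsq_ge0 // -/(enorm _) e1 expr1n.
  - by move=> i ij; rewrite mxE a0 // mulr0.
  - rewrite -scalemxAl linearZ /= normrZ normfV gtr0_norm // ler_pdivlMl //.
    by lra.
pose d : 'rV[R]_N := \row_i (if (i < j)%N then 1 / 2 else 3 / 2).
have cB : contractive (diag_mx d *m A).
  move=> a; pose a' : 'rV[R]_N := \row_i (if (i < j)%N then 0 else a 0 i).
  have -> : a *m (diag_mx d *m A) = 2^-1 *: (a *m A) + a' *m A.
    rewrite mulmxA scalemxAl -mulmxDl; congr (_ *m _).
    apply/rowP => i; rewrite mul_mx_diag !mxE; case: ifP => _.
      by rewrite addr0 mulrC; lra.
    by lra.
  rewrite linearD linearZ /= (le_trans (ler_normD _ _)) // normrZ.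
  have := cA a.
  have : `|comb (a' *m A)| <= enorm a' / 2.
    by apply: small => i ij; rewrite mxE ij.
  have : enorm a' <= enorm a.
    rewrite ler_sqrt ?sumsq_ge0 //; apply: ler_sum => i _; rewrite mxE.
    by case: ifP => // _; rewrite expr0n sqr_ge0.
  by rewrite ger0_norm ?invr_ge0 //; lra.
have := mA _ cB; rewrite det_mulmx det_diag normrM.
have : 3 / 2 <= \prod_i d 0 i.
  have -> : \prod_i d 0 i = (1 / 2) ^+ j * (3 / 2) ^+ (N - j).
    under eq_bigr do rewrite mxE.
    rewrite -(big_mkord xpredT (fun i => if (i < j)%N then 1 / 2 else 3 / 2)) /=.
    rewrite (big_cat_nat (n := j)) //=; last by lia.
    rewrite (eq_big_nat _ _ (F2 := fun=> 1 / 2)); last by move=> i /andP[_ ->].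
    rewrite [X in _ * X](eq_big_nat _ _ (F2 := fun=> 3 / 2)); last first.
      by move=> i /andP[ji _]; rewrite ltnNge ji.
    by rewrite !prodr_const_nat subn0.
  have -> : (N - j = 3 * j + (N - 4 * j).-1.+1)%N by lia.
  rewrite exprD exprM mulrA -exprMn (exprS _ _.-1).
  have e1 : 1 <= (1 / 2 * (3 / 2) ^+ 3) ^+ j :> R by rewrite exprn_ege1 //; lra.
  have e2 : 1 <= (3 / 2) ^+ (N - 4 * j).-1 :> R by rewrite exprn_ege1 //; lra.
  move: e1 e2; set p := (_ * _ ^+ 3) ^+ j; set q := _ ^+ _.-1 => e1 e2.
  by have := mulr_ege1 e1 e2; lra.
move=> dge; rewrite (ger0_norm (le_trans _ dge)); last by lra.
by have := ler_wpM2r (ltW dA) dge; lra.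
Qed.
End Frame.

(** The reflection exchanging [a] with the [j]-th unit vector; it fixes every unit
    vector orthogonal to both. *)
Lemma householder N (a : 'rV[R]_N) (j : 'I_N) : sumsq a = 1 ->
  exists U : 'M[R]_N, [/\ U *m U^T = 1%:M, row j U = a &
    forall i, i != j -> a 0 i = 0 -> row i U = delta_mx 0 i].
Proof.
move=> a1; pose w := a - delta_mx 0 j; pose s := sumsq w.
have wE k : w 0 k = a 0 k - (k == j)%:R by rewrite !mxE eqxx.
have sE : s = 2 * (1 - a 0 j).
  rewrite /s /sumsq; under eq_bigr => k _ do rewrite wE sqrrB.
  rewrite !big_split /= -[X in X + _ + _]/(sumsq a) a1 sumrN.
  rewrite (bigD1 j) //= eqxx mulr1 big1; last by move=> k /negbTE ->; rewrite mulr0 mul0rn.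
  rewrite [X in _ + X](bigD1 j) //= eqxx big1; last by move=> k /negbTE ->; rewrite expr0n.
  by rewrite expr1n; lra.
have [s0|sn0] := eqVneq s 0.
  have aE : a = delta_mx 0 j.
    apply/eqP; rewrite -subr_eq0; apply/eqP/rowP => k; rewrite -/w [RHS]mxE.
    apply/eqP; rewrite -sqrf_eq0 -[_ == 0]/(w 0 k ^+ 2 == 0).
    move/eqP: s0; rewrite /s /sumsq psumr_eq0; last by move=> i _; apply: sqr_ge0.
    by move=> /allP /(_ k); rewrite mem_index_enum => /(_ isT).
  exists 1%:M; split; first by rewrite trmx1 mulmx1.
    by rewrite rowE mulmx1 aE.
  by move=> i _ _; rewrite rowE mulmx1.
pose U : 'M[R]_N := 1%:M - (2 / s) *: (w^T *m w).
have UT : U^T = U by rewrite /U linearB /= trmx1 linearZ /= trmx_mul trmxK.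
have rowU k : row k U = delta_mx 0 k - (2 / s * w 0 k) *: w.
  rewrite rowE /U mulmxBr mulmx1 -scalemxAr mulmxA; congr (_ - _).
  have -> : delta_mx 0 k *m w^T = (w 0 k)%:M.
    by apply/matrixP => p q; rewrite !ord1 -rowE !mxE mulr1n.
  by rewrite mul_scalar_mx scalerA.
exists U; split.
- rewrite UT {2}/U mulmxBr mulmx1 -scalemxAr {2}/U mulmxBl mul1mx -scalemxAl.
  have -> : w^T *m w *m (w^T *m w) = s *: (w^T *m w).
    rewrite mulmxA -[w^T *m w *m w^T]mulmxA.
    have -> : w *m w^T = s%:M by rewrite [LHS]mx11_scalar -sumsq_mul.
    by rewrite mul_mx_scalar scalemxAl.
  rewrite scalerA /U scalerBr !scalerA -addrA -opprD -scalerBl -scalerDl.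
  have -> : 2 / s + (2 / s - 2 / s * (2 / s * s)) = 0 by field.
  by rewrite scale0r subr0.
- rewrite rowU wE eqxx; have -> : 2 / s * (a 0 j - true%:R) = -1.
    by rewrite sE mulr1n; field; move: sn0; rewrite sE mulf_eq0 negb_or => /andP[].
  by rewrite scaleN1r opprK /w addrC subrK.
- by move=> i ij ai; rewrite rowU wE ai (negbTE ij) subrr mulr0 scale0r subr0.
Qed.

Lemma orthogonal_sumsq N (U : 'M[R]_N) (a : 'rV[R]_N) :
  U *m U^T = 1%:M -> sumsq (a *m U) = sumsq a.
Proof.
by move=> UU; rewrite !sumsq_mul trmx_mul mulmxA -(mulmxA a) UU mulmx1.
Qed.

(** Rotating the frame so that a large tail vector becomes the next row keeps the
    ellipsoid, hence contractivity and determinant, and leaves the preceding rows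
    unchanged since the tail vector is orthogonal to them. *)
Lemma dvoretzky_rogers_frame N (b : 'I_N -> X) (j : nat) : lin_indep b ->
  (4 * j <= N)%N -> exists A, [/\ contractive b A, det_nearly_maximal b A &
    forall i : 'I_N, (i < j)%N -> 1 / 2 <= `|comb b (row i A)| ].
Proof.
move=> ib; elim: j => [|j IH] jN.
  by have [A cA mA] := exists_det_nearly_maximal ib; exists A; split.
have [|A [cA mA rA]] := IH; first by lia.
have [|a [a1 a0 aA]] := exists_large_tail_vector (j := j) cA mA; first by lia.
have jN' : (j < N)%N by lia.
have [U [UU Uj Ui]] := householder (Ordinal jN') a1.
have dU : `|\det U| = 1.
  have := congr1 determinant UU; rewrite det_mulmx det_tr det1 -expr2 => /eqP.
  by rewrite sqrf_eq1 => /orP[] /eqP ->; rewrite ?normrN normr1.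
exists (U *m A); split.
- by move=> v; rewrite mulmxA (le_trans (cA _)) // /enorm orthogonal_sumsq.
- by rewrite /det_nearly_maximal det_mulmx normrM dU mul1r.
- move=> i; rewrite ltnS leq_eqVlt row_mul => /orP[/eqP ij|ij].
    have -> : i = Ordinal jN' by apply: val_inj.
    by rewrite Uj.
  rewrite Ui ?a0 //; first by rewrite -rowE rA.
  by rewrite -val_eqE /= ltn_eqF.
Qed.

Lemma dvoretzky_rogers (m : nat) : infinite_dimensional X ->
  exists s : seq X, [/\ size s = m, weakly2_le1 s &
    forall v, v \in s -> 1 / 2 <= `|v| ].
Proof.
move=> infX; have [b ib] := exists_lin_indep infX (4 * m).
have [A [cA _ rA]] := dvoretzky_rogers_frame ib (leqnn _).
have le : (m <= 4 * m)%N by lia.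
pose v (i : 'I_(4 * m)) := comb b (row i A).
exists [seq v (widen_ord le i) | i <- enum 'I_m]; split.
- by rewrite size_map size_enum_ord.
- move=> c; rewrite big_map [leRHS]big_map !big_enum /=.
  rewrite -(big_ord_narrow (F := fun i => c (v i) *: v i) le).
  rewrite -(big_ord_narrow (F := fun i => c (v i) ^+ 2) le) /=.
  pose a : 'rV[R]_(4 * m) := \row_i (if (i < m)%N then c (v i) else 0).
  have -> : \sum_(i < 4 * m | (i < m)%N) c (v i) *: v i = comb b (a *m A).
    rewrite big_mkcond mulmx_sum_row linear_sum; apply: eq_bigr => i _.
    by rewrite linearZ /= mxE; case: ifP => // _; rewrite scale0r.
  have -> : \sum_(i < 4 * m | (i < m)%N) c (v i) ^+ 2 = sumsq a.
    rewrite big_mkcond; apply: eq_bigr => i _.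
    by rewrite mxE; case: ifP => // _; rewrite expr0n.
  by rewrite -(sqr_sqrtr (sumsq_ge0 a)) ler_pXn2r ?nnegrE ?sqrtr_ge0.
- by move=> _ /mapP[i _ ->]; apply: rA => /=.
Qed.
End DvoretzkyRogers.

(** * Sign sums with large mean and small variance *)

Section LargeMeans.
Context {R : realType} {X : normedModType R}.
Implicit Types (s : seq X) (x v : X).

(** With probability [2^-m] all the terms of the block equal [w]; otherwise only
    the bound [c] is used. *)
Lemma sign_mean_nseq_ge m v (w : X) (F : X -> R) (c : R) x :
  w = v \/ w = - v -> (forall y, c <= F y) ->
  2^-1 ^+ m * F (x + w *+ m) + (1 - 2^-1 ^+ m) * c <= sign_mean (nseq m v) F x.
Proof.
move=> wv cF; elim: m x => [|m IH] x /=.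
  by rewrite mulr0n addr0 expr0; lra.
have h z : c <= sign_mean (nseq m v) F z by apply: sign_mean_ge_cst.
have := IH (x + w); rewrite -addrA -mulrS exprS.
have := h (x + v); have := h (x - v).
by case: wv => ->; lra.
Qed.

(** The sign of the extreme value is chosen according to [x], so that the rest of
    the sum cannot cancel the block. *)
Lemma sign_mean_block_ge m v (F : X -> R) (c : R) x :
  (forall y, c <= F y) -> (forall y, `|y| <= F y) ->
  2^-1 ^+ m * (`|v| *+ m) + (1 - 2^-1 ^+ m) * c <= sign_mean (nseq m v) F x.
Proof.
move=> cF nF; have [w wv hw] : exists2 w, w = v \/ w = - v & `|v| *+ m <= `|x + w *+ m|.
  have := norm_le_halfsum (v *+ m) x; rewrite normrMn (addrC _ x) distrC.
  have [h|h] := leP (`|v| *+ m) `|x + v *+ m|; first by exists v => //; left.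
  by exists (- v); [right | rewrite mulNrn; lra].
apply: le_trans (sign_mean_nseq_ge m x wv cF); rewrite lerD2r; apply: ler_wpM2l.
  by rewrite exprn_ge0 // invr_ge0.
exact: le_trans hw (nF _).
Qed.

(** A block of [m] equal vectors [v / sqrt m] reaches the norm [sqrt m |v|] with
    probability at least [2^-m], so among [2^m] independent blocks one of them is
    likely to do so: this is how the mean is made to tend to infinity. *)
Lemma sign_mean_blocks_ge m s x : (forall v, v \in s -> 1 / 2 <= `|v|) ->
  (size s <= 2 ^ m)%N ->
  (size s)%:R * (2^-1 ^+ m * (Num.sqrt m%:R / 4)) <=
  sign_mean [seq y *: v | v <- s, y <- nseq m (Num.sqrt m%:R)^-1] (fun y => `|y|) x.
Proof.
set r := Num.sqrt _; set L := r / 4; set e := 2^-1 ^+ m => sv.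
have r0 : 0 <= r by apply: sqrtr_ge0.
have L0 : 0 <= L by rewrite divr_ge0.
have e0 : 0 <= e by rewrite exprn_ge0 // invr_ge0.
elim: s sv x => [|v s IH] sv x ss; first by rewrite mul0r normr_ge0.
rewrite allpairs_cons sign_mean_cat map_nseq.
have {}IH z : (size s)%:R * (e * L) <=
    sign_mean [seq y *: v | v <- s, y <- nseq m r^-1] (fun y => `|y|) z.
  by apply: IH; [move=> u us; apply: sv; rewrite inE us orbT | exact: ltnW].
have h := sign_mean_block_ge m (r^-1 *: v) x IH (fun y => sign_mean_norm_ge _ y).
apply: (le_trans _ h); rewrite -/e [size _]/= -natr1.
have bL : (size s)%:R * e <= 1.
  rewrite /e exprVn ler_pdivrMr ?exprn_gt0 // mul1r -natrX ler_nat.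
  exact: ltnW.
have : 2 * L <= `|r^-1 *: v| *+ m.
  have [m0|m0] := eqVneq m 0%N; first by rewrite /L /r m0 sqrtr0 mul0r mulr0 mulr0n.
  have rp : 0 < r by rewrite sqrtr_gt0 ltr0n lt0n.
  rewrite normrZ normfV (gtr0_norm rp) -[leRHS]mulr_natr.
  have -> : m%:R = r * r by rewrite -expr2 sqr_sqrtr ?ler0n.
  have -> : r^-1 * `|v| * (r * r) = r * `|v| by field; rewrite gt_eqF.
  by have := sv v (mem_head _ _); rewrite /L; nra.
move=> h2; have := ler_wpM2l e0 h2.
by have := ler_wpM2r (mulr_ge0 e0 L0) bL; lra.
Qed.

Lemma sign_mean_abs_le1 (ys : seq R) : \sum_(y <- ys) y ^+ 2 <= 1 ->
  sign_mean ys (fun t => `|t|) 0 <= 1.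
Proof.
move=> y1; have : (sign_mean ys (fun t => `|t|) 0) ^+ 2 <= 1.
  apply: (le_trans (sign_mean_jensen (phi := fun t => t ^+ 2) _ _ _ _)).
    by move=> a b; have := sqr_ge0 (a - b); nra.
  rewrite (eq_sign_mean _ _ (G := fun t => t ^+ 2)) ?sign_mean_sqr ?expr0n ?add0r //.
  by move=> t /=; rewrite real_normK ?num_real.
rewrite -[X in _ <= X -> _](expr1n _ 2) ler_pXn2r ?nnegrE //.
by apply: sign_mean_ge_cst.
Qed.

Lemma sign_mean_tensor_le s (ys : seq R) x : \sum_(y <- ys) y ^+ 2 <= 1 ->
  sign_mean [seq y *: v | v <- s, y <- ys] (fun y => `|y|) x <=
  `|x| + \sum_(v <- s) `|v|.
Proof.
move=> y1; elim: s x => [|v s IH] x; first by rewrite big_nil addr0.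
rewrite allpairs_cons sign_mean_cat big_cons.
apply: (le_trans (le_sign_mean _ _ IH)).
rewrite -[x in leLHS]add0r -sign_mean_translate -(scale0r v).
rewrite (sign_mean_map (L := fun t : R => t *: v)); last by move=> a b; rewrite scalerBl.
pose c := `|x| + \sum_(v <- s) `|v|.
apply: (@le_trans _ _ (sign_mean ys (fun t => c + `|v| * `|t|) 0)).
  apply: le_sign_mean => t /=; have := ler_normD (t *: v) x.
  by rewrite normrZ /c; lra.
rewrite sign_meanD sign_meanZ sign_mean_cst.
have := ler_wpM2l (normr_ge0 v) (sign_mean_abs_le1 y1); rewrite /c; lra.
Qed.

Lemma tensor_tensor s (ys zs : seq R) :
  [seq z *: w | w <- [seq y *: v | v <- s, y <- ys], z <- zs] =
  [seq t *: v | v <- s, t <- [seq z * y | y <- ys, z <- zs]].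
Proof.
elim: s => // v s IH; rewrite !allpairs_cons -IH allpairs_cat; congr (_ ++ _).
elim: {IH} ys => //= y ys IH; rewrite IH map_cat -map_comp; congr (_ ++ _).
by apply: eq_map => z /=; rewrite scalerA.
Qed.

Lemma sumsq_tensor (ys zs : seq R) :
  \sum_(t <- [seq z * y | y <- ys, z <- zs]) t ^+ 2 =
  (\sum_(y <- ys) y ^+ 2) * (\sum_(z <- zs) z ^+ 2).
Proof.
rewrite big_allpairs_dep /= mulr_suml; apply: eq_bigr => y _.
by rewrite mulr_sumr; apply: eq_bigr => z _; rewrite exprMn mulrC.
Qed.

(** Sign sums lack the rotation invariance of Gaussian sums, so replacing each
    sign by a sign sum of unit variance may change the mean of the norm.  It does
    not decrease it by more than a factor 4, by contraction and Khintchine's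
    inequality.  The upper bound is obtained by taking for [u] a near-maximiser
    of the mean among all tensor products of [s] with coefficient lists of
    Euclidean norm at most one: tensoring once more stays in that class. *)
Lemma exists_stable_family (K : R) : infinite_dimensional X ->
  exists u : seq X, let M := sign_mean u (fun y => `|y|) 0 in
  [/\ weakly2_le1 u, K <= M & forall zs : seq R, \sum_(z <- zs) z ^+ 2 = 1 ->
    M / 4 <= sign_mean [seq z *: w | w <- u, z <- zs] (fun y => `|y|) 0 <= 2 * M].
Proof.
move=> infX; pose m := (Num.trunc ((8 * `|K|) ^+ 2)).+1.
have mK : 8 * `|K| <= Num.sqrt m%:R.
  rewrite -[leLHS]ger0_norm ?mulr_ge0 // -sqrtr_sqr ler_sqrt //.
  by apply: ltW; apply: truncnS_gt.
have [s [ss ws ns]] := dvoretzky_rogers (2 ^ m) infX.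
pose P ys := sign_mean [seq y *: v | v <- s, y <- ys] (fun y => `|y|) 0.
pose E : set R := [set P ys | ys in [set ys | \sum_(y <- ys) y ^+ 2 <= 1]].
pose y0 := nseq m (Num.sqrt m%:R)^-1 : seq R.
have Ey0 : E (P y0).
  exists y0 => //=; rewrite big_nseq iter_addr_0 exprVn sqr_sqrtr //.
  by rewrite -[leLHS]mulr_natr mulVf // pnatr_eq0.
have ubE : has_ubound E.
  by exists (`|0 : X| + \sum_(v <- s) `|v|) => _ [ys /= y1 <-]; apply: sign_mean_tensor_le.
have Ple : P y0 <= sup E by apply: ub_le_sup.
have Pge : 2 * `|K| <= P y0.
  have := @sign_mean_blocks_ge m s 0 ns; rewrite ss leqnn => /(_ isT).
  rewrite mulrA natrX -exprMn mulfV // expr1n mul1r -/y0 -/(P y0).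
  by lra.
have sE : has_sup E by split => //; exists (P y0).
have [S0|S0] := leP (sup E) 0.
  have K0 : K <= 0 by have := ler_norm K; lra.
  exists [::]; split => /=.
  - by move=> c; rewrite !big_nil normr0 expr0n.
  - by rewrite normr0.
  - by move=> zs _; rewrite normr0; lra.
have S2 : 0 < sup E / 2 by lra.
have [_ [ys /= y1 <-] hys] := sup_adherent S2 sE.
exists [seq y *: v | v <- s, y <- ys]; rewrite -/(P ys) /=; split.
- exact: weakly2_tensor.
- by have := ler_norm K; lra.
- move=> zs z1; apply/andP; split.
    have -> : P ys / 4 = sign_mean
        [seq 4^-1 *: u | u <- [seq y *: v | v <- s, y <- ys]] (fun y => `|y|) 0.
      by rewrite -[X in _ = sign_mean _ _ X](scaler0 _ 4^-1) sign_mean_normZ ?invr_ge0 // mulrC.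
    apply: sign_mean_tensor_ge; first exact: convex_norm.
    have := @khintchine _ zs 1 ler01; rewrite z1 expr1n mul1r invr_ge0 => /(_ erefl) ->.
    by rewrite andbT.
  rewrite tensor_tensor -/(P _).
  have : P [seq z * y | y <- ys, z <- zs] <= sup E.
    apply: ub_le_sup => //; exists [seq z * y | y <- ys, z <- zs] => //=.
    by rewrite sumsq_tensor z1 mulr1.
  by lra.
Qed.

(** * Dvoretzky's theorem for finitely many directions *)

Section FiniteDvoretzky.
Context {k : nat}.

Definition single (i : 'I_k) (w : X) : {ffun 'I_k -> X} :=
  [ffun j => if j == i then w else 0].

Definition apply_coefs (z : 'I_k -> R) (W : {ffun 'I_k -> X}) : X :=
  \sum_i z i *: W i.

Lemma apply_coefsB z : {morph apply_coefs z : a b / a - b}.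
Proof.
move=> a b; rewrite /apply_coefs -sumrB; apply: eq_bigr => i _.
by rewrite !ffunE scalerBr.
Qed.

Lemma apply_coefs_single z i w : apply_coefs z (single i w) = z i *: w.
Proof.
rewrite /apply_coefs (bigD1 i) //= ffunE eqxx big1 ?addr0 // => j /negbTE ji.
by rewrite ffunE ji scaler0.
Qed.

(** A single random family [W] serves all the directions [z] at once; in each of
    them its combination is a sign sum over a tensor product of [u]. *)
Lemma sign_mean_apply_coefs (u : seq X) z (F : X -> R) :
  sign_mean [seq single i w | w <- u, i <- enum 'I_k] (F \o apply_coefs z) 0 =
  sign_mean [seq t *: w | w <- u, t <- [seq z i | i <- enum 'I_k]] F 0.
Proof.
rewrite -(sign_mean_map _ _ _ (@apply_coefsB z)).
have -> : apply_coefs z 0 = 0.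
  by rewrite /apply_coefs big1 // => i _; rewrite ffunE scaler0.
congr (sign_mean _ _ _); rewrite map_allpairs [RHS]allpairs_mapr.
by apply: eq_allpairs => w i; apply: apply_coefs_single.
Qed.

(** The mean squared deviations of the norms from their means [Ma a], added over
    all directions, are at most [2 n].  Some [W] does as well, and since
    [M / 8 >= 2 n + 1] each of its norms is within [M / 8] of its mean, which lies
    between [M / 4] and [2 M]. *)
Lemma unit_dvoretzky (I : finType) (z : I -> 'I_k -> R) :
  infinite_dimensional X -> (forall a, \sum_i z a i ^+ 2 = 1) ->
  exists w : 'I_k -> X, forall a, 1 / 17 <= `|\sum_i z a i *: w i| <= 1.
Proof.
move=> infX z1; pose n : R := #|I|%:R.
have n0 : 0 <= n by rewrite ler0n.
have [u [wu KM uM]] := exists_stable_family (8 * (2 * n + 1)) infX.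
set M := sign_mean u _ 0 in KM uM.
have zz a : \sum_(t <- [seq z a i | i <- enum 'I_k]) t ^+ 2 = 1.
  by rewrite big_map big_enum /= z1.
pose Ma a := sign_mean [seq t *: w | w <- u, t <- [seq z a i | i <- enum 'I_k]]
  (fun y => `|y|) 0.
pose dev a (W : {ffun 'I_k -> X}) := (`|apply_coefs (z a) W| - Ma a) ^+ 2.
have var a : sign_mean [seq single i w | w <- u, i <- enum 'I_k] (dev a) 0 <= 2.
  have -> : dev a = (fun y => (`|y| - Ma a) ^+ 2) \o apply_coefs (z a) by [].
  rewrite sign_mean_apply_coefs.
  rewrite (eq_sign_mean _ _ (G := fun y => `|y| ^+ 2 + (- (2 * Ma a) *
    `|y| + Ma a ^+ 2))); last first.
    by move=> y; ring.
  rewrite !sign_meanD sign_meanZ sign_mean_cst -/(Ma a).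
  have w2 : weakly2_le1 [seq t *: w | w <- u, t <- [seq z a i | i <- enum 'I_k]].
    by apply: weakly2_tensor => //; rewrite zz.
  by have := sign_mean_variance 0 w2; rewrite -/(Ma a); lra.
have [W hW] : exists W, \sum_a dev a W <= 2 * n.
  apply: (@sign_mean_witness _ _ [seq single i w | w <- u, i <- enum 'I_k] _ 0).
  rewrite sign_mean_sum; apply: (le_trans (ler_sum _ (fun a _ => var a))).
  by rewrite sumr_const -[leLHS]mulr_natr.
have M0 : 0 < M by lra.
have close a : `| `|apply_coefs (z a) W| - Ma a| <= M / 8.
  have : dev a W <= (M / 8) ^+ 2.
    apply: (@le_trans _ _ (2 * n)); last by nra.
    apply: (le_trans _ hW); rewrite (bigD1 a) //= lerDl.
    by apply: sumr_ge0 => b _; apply: sqr_ge0.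
  by rewrite /dev -real_normK ?num_real // ler_pXn2r ?nnegrE //; lra.
exists (fun i => (17 * M / 8)^-1 *: W i) => a.
have -> : \sum_i z a i *: ((17 * M / 8)^-1 *: W i) = (17 * M / 8)^-1 *: apply_coefs (z a) W.
  by rewrite /apply_coefs scaler_sumr; apply: eq_bigr => i _; rewrite !scalerA mulrC.
rewrite normrZ normfV gtr0_norm; last by lra.
have := close a; rewrite ler_norml => /andP[h1 h2].
have /andP[h3 h4] := uM _ (zz a); rewrite -/(Ma a) in h3 h4.
by rewrite ler_pdivlMl ?ler_pdivrMl; lra.
Qed.

Lemma finite_dvoretzky (I : finType) (z : I -> 'I_k -> R) :
  infinite_dimensional X ->
  exists w : 'I_k -> X, forall a, let r := Num.sqrt (\sum_i z a i ^+ 2) in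
    r / 17 <= `|\sum_i z a i *: w i| <= r.
Proof.
move=> infX; pose r a := Num.sqrt (\sum_i z a i ^+ 2).
have r0 a : 0 <= r a by apply: sqrtr_ge0.
have s0 a : 0 <= \sum_i z a i ^+ 2 by apply: sumr_ge0 => i _; apply: sqr_ge0.
pose J := {a : I | r a != 0}.
have [|w hw] := unit_dvoretzky (z := fun (a : J) i => (r (val a))^-1 * z (val a) i) infX.
  move=> [a ra] /=; under eq_bigr do rewrite exprMn.
  rewrite -big_distrr /= exprVn sqr_sqrtr // mulVf //.
  by apply: contra_neq ra => e0; rewrite /r e0 sqrtr0.
exists w => a /=; rewrite -/(r a).
have [ra|ra] := eqVneq (r a) 0.
  have z0 i : z a i = 0.
    move/eqP: ra; rewrite sqrtr_eq0 => le0.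
    have /eqP : \sum_i z a i ^+ 2 = 0 by apply/eqP; rewrite eq_le le0 s0.
    rewrite psumr_eq0; last by move=> j _; apply: sqr_ge0.
    by move=> /allP /(_ i); rewrite mem_index_enum sqrf_eq0 => /(_ isT) /eqP.
  rewrite ra big1; first by rewrite normr0 mul0r lexx.
  by move=> i _; rewrite z0 scale0r.
have rp : 0 < r a by rewrite lt_def ra r0.
have := hw (exist _ a ra); rewrite /=.
have -> : \sum_i ((r a)^-1 * z a i) *: w i = (r a)^-1 *: \sum_i z a i *: w i.
  by rewrite scaler_sumr; apply: eq_bigr => i _; rewrite scalerA.
rewrite normrZ normfV gtr0_norm // ler_pdivlMl // ler_pdivrMl // mulr1 mul1r.
by [].
Qed.
End FiniteDvoretzky.
End LargeMeans.

(** * Finite orthonormal expansions *)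

Section InnerProduct.
Context {R : realType} {H : lmodType R} (ip : {dot H for idfun}).
Implicit Types (x y u v : H) (e : seq H).

Lemma ipC x y : ip x y = ip y x.
Proof. by rewrite [LHS]hermitian_subproof expr0 mul1r. Qed.

Lemma ipBr x y z : ip x (y - z) = ip x y - ip x z.
Proof. exact: zmod_morphismr_subproof. Qed.

Lemma ip_0r x : ip x 0 = 0.
Proof. by rewrite -(subrr x) ipBr subrr. Qed.

Lemma ipZr x (a : R) y : ip x (a *: y) = a * ip x y.
Proof. exact: linearr_subproof. Qed.

Lemma ip_sumr x (I : Type) (r : seq I) (E : I -> H) :
  ip x (\sum_(i <- r) E i) = \sum_(i <- r) ip x (E i).
Proof. exact: linear_sumr. Qed.

Lemma ip_gt0 x : x != 0 -> 0 < ip x x.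
Proof. exact: neq0_dnorm_gt0. Qed.

(** For orthonormal [e], membership in its span; the condition by itself entails
    Parseval's identity. *)
Definition expands_along e x := x = \sum_(v <- e) ip x v *: v.

Lemma expands_along_ip e x y : expands_along e x ->
  ip y x = \sum_(v <- e) ip x v * ip y v.
Proof.
by move=> {1}->; rewrite ip_sumr; apply: eq_bigr => v _; rewrite ipZr.
Qed.

Lemma expands_alongB e x y :
  expands_along e x -> expands_along e y -> expands_along e (x - y).
Proof.
rewrite /expands_along => {1}-> {1}->; rewrite -sumrB; apply: eq_bigr => v _.
by rewrite -scalerBl ![ip _ v]ipC -ipBr.
Qed.

Lemma expands_alongZ e a x : expands_along e x -> expands_along e (a *: x).
Proof.
rewrite /expands_along => {1}->; rewrite scaler_sumr; apply: eq_bigr => v _.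
by rewrite scalerA ![ip _ v]ipC ipZr.
Qed.

Lemma gram_schmidt (s : seq H) : exists e,
  (forall x, x \in e -> expands_along e x) /\
  (forall x, x \in s -> expands_along e x).
Proof.
elim: s => [|p s [e [ee es]]]; first by exists [::].
pose r := p - \sum_(v <- e) ip p v *: v.
have re w : w \in e -> ip w r = 0.
  move=> we; rewrite ipBr ip_sumr (ipC w) (expands_along_ip p (ee w we)).
  by apply/eqP; rewrite subr_eq0; apply/eqP; apply: eq_bigr => v _; rewrite ipZr mulrC.
have [r0|rn0] := eqVneq r 0.
  exists e; split => // x; rewrite inE => /orP[/eqP ->|]; last exact: es.
  by apply/eqP; rewrite -subr_eq0 -/r r0.
have rr := ip_gt0 rn0; pose a := Num.sqrt (ip r r).
have a0 : 0 < a by rewrite sqrtr_gt0.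
have aa : a * a = ip r r by rewrite -expr2 sqr_sqrtr // ltW.
pose u := a^-1 *: r.
have ue w : w \in e -> ip w u = 0 by move=> we; rewrite ipZr re // mulr0.
have old x : expands_along e x -> expands_along (u :: e) x.
  move=> xe; rewrite /expands_along big_cons.
  have -> : ip x u = 0.
    rewrite ipC (expands_along_ip u xe) big_seq big1 // => v ve.
    by rewrite (ipC u) ue // mulr0.
  by rewrite scale0r add0r.
exists (u :: e); split => x; rewrite inE => /orP[/eqP ->|xin].
- rewrite /expands_along big_cons big_seq big1; last first.
    by move=> v ve; rewrite ipC ue // scale0r.
  have -> : ip u u = 1.
    by rewrite /u ipZr ipC ipZr -aa; field; rewrite gt_eqF.
  by rewrite scale1r addr0.
- exact/old/ee.
- rewrite /expands_along big_cons.
  have -> : ip p u = a.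
    have : ip u (p - r) = 0.
      rewrite /r opprB addrC subrK ip_sumr big_seq big1 // => v ve.
      by rewrite ipZr (ipC u) ue // mulr0.
    rewrite ipBr => /eqP; rewrite subr_eq0 => /eqP; rewrite ipC => ->.
    by rewrite ipC /u ipZr -aa; field; rewrite gt_eqF.
  by rewrite /u scalerA divff ?gt_eqF // scale1r subrK.
- exact/old/es.
Qed.

Lemma expands_along_sumsq e x : expands_along e x ->
  \sum_(t <- [seq ip x v | v <- e]) t ^+ 2 = ip x x.
Proof.
move=> xe; rewrite [RHS](expands_along_ip x xe) big_map.
by apply: eq_bigr => v _; rewrite expr2.
Qed.

Lemma sign_mean_ip e x (F : R -> R) :
  sign_mean e (fun S => F (ip x S)) 0 = sign_mean [seq ip x v | v <- e] F 0.
Proof.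
rewrite -[X in _ = sign_mean _ _ X](ip_0r x).
by rewrite (sign_mean_map (L := ip x)) // => a b; rewrite ipBr.
Qed.
End InnerProduct.

(** * The Johnson-Lindenstrauss lemma *)

(** Method of conditional expectations: the rows are fixed one at a time, each
    keeping the weighted sum below its mean. *)
Lemma choose_rows {R : realType} (V : lmodType R) (s : seq V) (I : finType)
    (phi : I -> V -> R) (k : nat) (c : I -> R) :
  (forall i, 0 <= c i) -> (forall i y, 0 <= phi i y) ->
  (forall i, sign_mean s (phi i) 0 <= 1) ->
  exists S : 'I_k -> V,
    \sum_i c i * \prod_(j < k) phi i (S j) <= \sum_i c i.
Proof.
move=> c0 phi0 phi1; elim: k c c0 => [|k IH] c c0.
  exists (fun=> 0); apply: ler_sum => i _; by rewrite big_ord0 mulr1.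
have [y hy] : exists y, \sum_i c i * phi i y <= \sum_i c i.
  apply: (@sign_mean_witness _ _ s _ 0); rewrite sign_mean_sum.
  apply: ler_sum => i _; rewrite sign_meanZ -[leRHS]mulr1.
  exact: ler_wpM2l.
have [|S hS] := IH (fun i => c i * phi i y); first by move=> i; rewrite mulr_ge0.
exists (cons_family y S); apply: le_trans hy; apply: le_trans hS.
apply: ler_sum => i _; rewrite big_ord_recl /cons_family unlift_none mulrA /=.
apply: ler_wpM2l; first by rewrite mulr_ge0.
by apply: ler_prod => j _; rewrite liftK phi0 /=.
Qed.

Section JohnsonLindenstrauss.
Context {R : realType} {H : lmodType R} (ip : {dot H for idfun}).

(** Exponential Chebyshev inequality in both directions.  The exponents of [up]
    and [dn] are normalised to have exponential mean at most one, so for suitable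
    rows their sums over the [k] rows are all at most [ln (2 |I|)]. *)
Lemma unit_johnson_lindenstrauss (e : seq H) (I : finType) (z : I -> H) (k : nat) :
  (forall a, expands_along ip e (z a)) -> (forall a, ip (z a) (z a) = 1) ->
  24 * ln (2 * #|I|%:R) <= k%:R :> R ->
  exists S : 'I_k -> H, forall a,
    k%:R / 4 <= \sum_i ip (z a) (S i) ^+ 2 <= 3 * k%:R.
Proof.
move=> ze z1 kI; pose n : R := #|I|%:R.
have zs a : \sum_(t <- [seq ip (z a) v | v <- e]) t ^+ 2 = 1.
  by rewrite expands_along_sumsq.
pose up a (S : H) : R := 16^-1 * ip (z a) S ^+ 2 - 8^-1.
pose dn a (S : H) : R := 12^-1 - ip (z a) S ^+ 2 / 6.
pose phi (i : I + I) S := expR (match i with inl a => up a S | inr a => dn a S end).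
have [|||S] := @choose_rows R H e _ phi k (fun=> 1).
- by [].
- by move=> i y; apply: expR_ge0.
- case=> a; rewrite /phi.
    rewrite (eq_sign_mean _ _
      (G := fun S => expR (- 8^-1) * expR (16^-1 * ip (z a) S ^+ 2))); last first.
      by move=> S; rewrite /up addrC expRD.
    rewrite sign_meanZ (sign_mean_ip _ _ _ (fun t => expR (16^-1 * t ^+ 2))).
    rewrite -[leRHS](expRxMexpNx_1 8^-1) mulrC ler_wpM2r ?expR_ge0 //.
    have := @sign_mean_exp_sqr _ [seq ip (z a) v | v <- e] 16^-1 0.
    rewrite zs => h; apply: (le_trans (h _ _)); [by rewrite invr_ge0|lra|].
    have -> : 16^-1 / (1 - 8 / 16 * 1) * (0 ^+ 2 + 1) = 8^-1 :> R by field.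
    exact: lexx.
  rewrite (eq_sign_mean _ _
    (G := fun S => expR (12^-1) * expR (- (ip (z a) S ^+ 2 / 6)))); last first.
    by move=> S; rewrite /dn expRD.
  rewrite sign_meanZ (sign_mean_ip _ _ _ (fun t => expR (- (t ^+ 2 / 6)))).
  rewrite -[leRHS](expRxMexpNx_1 12^-1) ler_wpM2l ?expR_ge0 //.
  apply: (le_trans (sign_mean_exp_neg (zs a))).
  by apply: le_trans (expR_ge1Dx _); lra.
- rewrite sumr_const card_sum addnn => hS; exists S => a.
  have n0 : 0 < n by rewrite ltr0n; apply/card_gt0P; exists a.
  have lnE : expR (ln (2 * n)) = 2 * n by rewrite lnK // posrE mulr_gt0.
  have each i : \sum_(j < k)
      (match i with inl a => up a (S j) | inr a => dn a (S j) end) <= ln (2 * n).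
    rewrite -ler_expR lnE expR_sum.
    have -> : 2 * n = 1 *+ (#|I|.*2)%N by rewrite -muln2 mulrC natrM.
    apply: le_trans hS; rewrite (bigD1 i) //= mul1r lerDl.
    by apply: sumr_ge0 => j _; rewrite mul1r; apply: prodr_ge0 => l _; apply: expR_ge0.
  have := each (inl a); have := each (inr a).
  rewrite /up /dn !sumrB !sumr_const -mulr_suml -mulr_sumr !card_ord.
  rewrite -(mulr_natr 12^-1) -(mulr_natr 8^-1) => h1 h2.
  by apply/andP; split; lra.
Qed.

Lemma johnson_lindenstrauss (s : seq H) (I : finType) (z : I -> H) (k : nat) :
  (forall a, exists x y, [/\ x \in s, y \in s & z a = x - y]) ->
  24 * ln (2 * #|I|%:R) <= k%:R :> R ->
  exists S : 'I_k -> H, forall a, let r := ip (z a) (z a) in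
    k%:R / 4 * r <= \sum_i ip (z a) (S i) ^+ 2 <= 3 * k%:R * r.
Proof.
move=> zs kI; have [e [_ es]] := gram_schmidt ip s.
have ze a : expands_along ip e (z a).
  by have [x [y [xs ys ->]]] := zs a; apply: expands_alongB; apply: es.
pose J := {a : I | z a != 0}.
pose c (a : I) := (Num.sqrt (ip (z a) (z a)))^-1.
have cE a : z a != 0 -> c a ^+ 2 = (ip (z a) (z a))^-1.
  by move=> /(ip_gt0 ip)/ltW h; rewrite /c exprVn sqr_sqrtr.
have [|||S hS] := @unit_johnson_lindenstrauss e J (fun a => c (val a) *: z (val a)) k.
- by move=> a; apply: expands_alongZ.
- move=> [a za] /=; rewrite ipZr ipC ipZr mulrA -expr2 cE // mulVf //.
  by rewrite gt_eqF // ip_gt0.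
- apply: le_trans kI; rewrite ler_pM2l //.
  have [->|J0] := posnP #|{: J}|.
    rewrite mulr0 ln0 //; have [->|I0] := posnP #|I|; first by rewrite mulr0 ln0.
    by apply: ln_ge0; rewrite -natrM ler1n muln_gt0.
  have IJ : (#|{: J}| <= #|I|)%N by rewrite card_sig max_card.
  rewrite ler_ln ?posrE ?mulr_gt0 ?ltr0n //; last exact: leq_trans IJ.
  by rewrite ler_pM2l // ler_nat.
- exists S => a /=; have [za|za] := eqVneq (z a) 0.
    have ip0 y : ip (z a) y = 0 by rewrite za ipC ip_0r.
    rewrite ip0 !mulr0 big1 ?lexx // => i _.
    by rewrite ip0 expr0n.
  have r0 := ip_gt0 ip za.
  have := hS (exist _ a za) => /=.
  have -> : \sum_i ip (c a *: z a) (S i) ^+ 2 =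
            (ip (z a) (z a))^-1 * \sum_i ip (z a) (S i) ^+ 2.
    rewrite mulr_sumr -cE //; apply: eq_bigr => i _.
    by rewrite ipC ipZr exprMn ipC.
  by rewrite ler_pdivlMl // ler_pdivrMl // => /andP[h1 h2]; apply/andP; split; lra.
Qed.
End JohnsonLindenstrauss.

Lemma ln2_bounds (R : realType) : 1 / 2 <= (ln 2 : R) <= 1.
Proof.
have h1 : ln 2 <= 1 :> R.
  by have := @le_ln1Dx R 1; have -> : 1 + 1 = 2 :> R by []; apply; lra.
have h2 : ln (2^-1) <= - (1 / 2) :> R.
  have := @le_ln1Dx R (- (1 / 2)).
  have -> : 1 + - (1 / 2) = 2^-1 :> R by lra.
  by apply; lra.
rewrite lnV ?posrE // in h2.
by apply/andP; split; lra.
Qed.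

(** * Hilbert space points inside [X] *)

Section HilbertIntoSpan.
Context {R : realType} {X : normedModType R} {H : normedModType R}.

(** Both steps control the finitely many differences of points of [s].  After
    division by [sqrt k] the projection changes lengths by factors between [1/2]
    and [sqrt 3], and the map into [X] by factors between [1/17] and [1]. *)
Lemma hilbert_into_span (ip : {dot H for idfun}) (s : seq H) (k : nat) :
  infinite_dimensional X -> (forall x, ip x x = `|x| ^+ 2) -> (0 < k)%N ->
  24 * ln (2 * (size s)%:R ^+ 2) <= k%:R :> R ->
  exists (w : 'I_k -> X) (h : H -> X), (forall y, span_of w (h y)) /\
    forall x y, x \in s -> y \in s ->
      `|x - y| / 34 <= `|h x - h y| <= 2 * `|x - y|.
Proof.
move=> infX ipn k0 ks; pose I := ('I_(size s) * 'I_(size s))%type.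
pose z (a : I) : H := nth 0 s a.1 - nth 0 s a.2.
have [||S hS] := @johnson_lindenstrauss _ _ ip s I z k.
- by move=> a; exists (nth 0 s a.1), (nth 0 s a.2); rewrite !mem_nth.
- by rewrite card_prod card_ord natrM -expr2.
have [w hw] := finite_dvoretzky (fun (a : I) i => ip (z a) (S i)) infX.
have kp : 0 < k%:R :> R by rewrite ltr0n.
pose c := (Num.sqrt k%:R)^-1 : R.
have c0 : 0 < c by rewrite invr_gt0 sqrtr_gt0.
have ck : c ^+ 2 * k%:R = 1 by rewrite /c exprVn sqr_sqrtr ?mulVf ?gt_eqF // ltW.
exists w, (fun y => \sum_i (c * ip y (S i)) *: w i); split.
  by move=> y; exists (fun i => c * ip y (S i)).
move=> x y xs ys;
pose a : I := (Ordinal (etrans (index_mem x s) xs),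
               Ordinal (etrans (index_mem y s) ys)).
have za : z a = x - y by rewrite /z /= !nth_index.
have -> : \sum_i (c * ip x (S i)) *: w i - \sum_i (c * ip y (S i)) *: w i =
    c *: \sum_i ip (z a) (S i) *: w i.
  rewrite -sumrB scaler_sumr; apply: eq_bigr => i _.
  by rewrite -scalerBl scalerA -mulrBr za [ip x _]ipC [ip y _]ipC -ipBr ipC.
rewrite normrZ gtr0_norm //.
have := hS a; have := hw a; rewrite /= ipn za.
set q := \sum_i ip _ _ ^+ 2; set r := Num.sqrt q; set d := `|x - y|.
set W := `|_| => /andP[w1 w2] /andP[q1 q2].
have d0 : 0 <= d by apply: normr_ge0.
have r0 : 0 <= r by apply: sqrtr_ge0.
have q0 : 0 <= q by apply: sumr_ge0 => i _; apply: sqr_ge0.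
have rq : (c * r) ^+ 2 = c ^+ 2 * q by rewrite exprMn sqr_sqrtr.
have c20 : 0 <= c ^+ 2 by apply: sqr_ge0.
have m1 : d / 2 <= c * r.
  rewrite -[X in X <= _]ger0_norm ?divr_ge0 // -[X in _ <= X]ger0_norm ?mulr_ge0 ?(ltW c0) //.
  rewrite -ler_sqr ?nnegrE // !real_normK ?num_real // rq.
  have := ler_wpM2l c20 q1.
  have -> : c ^+ 2 * (k%:R / 4 * d ^+ 2) = (c ^+ 2 * k%:R) * (d / 2) ^+ 2 by field.
  by rewrite ck mul1r.
have m2 : c * r <= 2 * d.
  rewrite -[X in X <= _]ger0_norm ?mulr_ge0 ?(ltW c0) // -[X in _ <= X]ger0_norm ?mulr_ge0 //.
  rewrite -ler_sqr ?nnegrE // !real_normK ?num_real // rq.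
  have := ler_wpM2l c20 q2.
  have -> : c ^+ 2 * (3 * k%:R * d ^+ 2) = (c ^+ 2 * k%:R) * (3 * d ^+ 2) by ring.
  rewrite ck mul1r => /le_trans; apply.
  by have := sqr_ge0 d; lra.
have := ler_wpM2l (ltW c0) w1; have := ler_wpM2l (ltW c0) w2.
by move=> h1 h2; apply/andP; split; lra.
Qed.
End HilbertIntoSpan.

(** * Radial retraction *)

Section Truncation.
Context {R : realType} {X : normedModType R}.
Implicit Types (v : X) (r : R).

Definition retract r v : X := if `|v| <= r then v else (r / `|v|) *: v.

Lemma retract_scale r v : 0 <= r ->
  exists t, [/\ 0 <= t <= 1, retract r v = t *: v & t * `|v| = Num.min `|v| r].
Proof.
move=> r0; rewrite /retract; have [h|h] := leP `|v| r.
  by exists 1; rewrite scale1r mul1r ler01 lexx.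
have v0 : 0 < `|v| by apply: le_lt_trans h.
exists (r / `|v|); split => //; last by rewrite divfK // gt_eqF.
by rewrite divr_ge0 //= ler_pdivrMr // mul1r ltW.
Qed.

Lemma norm_retract_le r v : 0 <= r -> `|retract r v| <= r.
Proof.
move=> r0; have [t [/andP[t0 _] -> tv]] := retract_scale v r0.
by rewrite normrZ ger0_norm // tv ge_min lexx orbT.
Qed.

Lemma retract_lipschitz r u v : 0 <= r ->
  `|retract r u - retract r v| <= 2 * `|u - v|.
Proof.
move=> r0; wlog uv : u v / `|u| <= `|v|.
  move=> W; have [/W //|/ltW/W] := leP `|u| `|v|.
  by rewrite distrC (distrC v).
have [s [/andP[s0 s1] -> su]] := retract_scale u r0.
have [t [/andP[t0 t1] -> tv]] := retract_scale v r0.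
have -> : s *: u - t *: v = (s - t) *: u + t *: (u - v).
  by rewrite scalerBl scalerBr addrA subrK.
apply: (le_trans (ler_normD _ _)); rewrite !normrZ (ger0_norm t0).
have hd : `|v| - `|u| <= `|u - v| by rewrite distrC; apply: lerB_dist.
have d0 : 0 <= `|u - v| by [].
have mm : Num.min `|u| r <= Num.min `|v| r by rewrite le_min !ge_min uv lexx orbT.
have u0 : 0 <= `|u| by [].
have td : 0 <= (1 - t) * `|u - v| by rewrite mulr_ge0 ?subr_ge0.
have tu : t * `|u| <= s * `|u|.
  rewrite su le_min; apply/andP; split; first by nra.
  by have : t * `|v| <= r; [rewrite tv ge_min lexx orbT | nra].
have -> : `|s - t| * `|u| = s * `|u| - t * `|u|.
  by rewrite -[in LHS](normr_id u) -normrM mulrBl ger0_norm // subr_ge0.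
rewrite su; have : 0 <= (1 - t) * (`|v| - `|u|) by rewrite mulr_ge0 ?subr_ge0.
by lra.
Qed.
End Truncation.

(** * Quantitative form of the hypotheses on [f] *)

Section Moduli.
Context {R : realType} {X H : normedModType R} (f : X -> H).

Lemma lipschitz_bound : [lipschitz f x | x in unit_ball X] ->
  exists2 L : R, 0 < L & forall x y, `|x| <= 1 -> `|y| <= 1 ->
    `|f x - f y| <= L * `|x - y|.
Proof.
move=> /pinfty_ex_gt0 [L L0 fL]; exists L => // x y x1 y1.
exact: (fL (x, y)).
Qed.

Lemma inverse_modulus (eps : R) : {in unit_ball X &, injective f} ->
  unif_continuous (pinv (unit_ball X) f : subspace (f @` unit_ball X) -> X) ->
  0 < eps -> exists2 del : R, 0 < del & forall x y, `|x| <= 1 -> `|y| <= 1 ->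
    eps <= `|x - y| -> del <= `|f x - f y|.
Proof.
move=> fI fU eps0.
have [E + sub] := fU _ (entourage_ball X (PosNum eps0)).
 rewrite -entourage_ballE => -[d /= d0 dE].
exists d => // x y x1 y1 xy; rewrite leNgt; apply/negP => fxy.
have /= := sub (f x, f y); rewrite !pinvKV ?inE // => h.
suff : ball x eps y by rewrite -ball_normE /= ltNge xy.
apply: h; right; split; first by exists x.
split; first by exists y.
by apply: dE => /=; rewrite -ball_normE.
Qed.
End Moduli.

(** * Average distances *)

Section SeqSums.
Context {R : realType} {T : eqType}.
Implicit Types (s : seq T) (F : T -> R).

Lemma sum_cst_seq s (c : R) : \sum_(x <- s) c = (size s)%:R * c.
Proof. by rewrite big_const_seq count_predT iter_addr_0 mulr_natl. Qed.

Lemma ler_sum_mem s F G : {in s, forall x, F x <= G x} ->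
  \sum_(x <- s) F x <= \sum_(x <- s) G x.
Proof. by move=> FG; rewrite big_seq [leRHS]big_seq; apply: ler_sum. Qed.

Lemma exists_le_mean s F : s != [::] ->
  exists2 x, x \in s & (size s)%:R * F x <= \sum_(y <- s) F y.
Proof.
move=> s0; have [x xs xmin] : exists2 x, x \in s & {in s, forall y, F x <= F y}.
  elim: s s0 => // a [|b s] IH _.
    by exists a => [|y]; rewrite inE // => /eqP ->.
  have [//|x xs xmin] := IH; have [ax|xa] := leP (F a) (F x).
    exists a; first exact: mem_head.
    by move=> y; rewrite inE => /orP[/eqP -> //|/xmin]; apply: le_trans.
  exists x; first by rewrite inE xs orbT.
  by move=> y; rewrite inE => /orP[/eqP ->|/xmin //]; apply: ltW.
by exists x => //; rewrite -sum_cst_seq; apply: ler_sum_mem.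
Qed.
End SeqSums.

Section AverageEmbedding.
Context {R : realType} {X H : normedModType R}.

Lemma span_ofZ d (w : 'I_d -> X) (a : R) x :
  span_of w x -> span_of w (a *: x).
Proof.
move=> [c _ <-]; exists (fun i => a * c i) => //.
by rewrite scaler_sumr; apply: eq_bigr => i _; rewrite scalerA.
Qed.

Lemma span_of_const d (v : X) (a : R) : (0 < d)%N ->
  span_of (fun _ : 'I_d => v) (a *: v).
Proof.
move=> d0; exists (fun=> a / d%:R) => //.
rewrite -scaler_suml sumr_const card_ord -[X in X *: _]mulr_natr divfK //.
by rewrite pnatr_eq0 -lt0n.
Qed.

Definition excess (r : R) (v : X) := Num.max 0 (`|v| - r).

Lemma norm_sub_retract r v : 0 <= r -> `|v - retract r v| = excess r v.
Proof.
move=> r0; rewrite /retract /excess; have [h|h] := leP `|v| r.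
  by rewrite subrr normr0; apply/esym/max_idPl; lra.
have v0 : 0 < `|v| by apply: le_lt_trans h.
rewrite -{1}(scale1r v) -scalerBl normrZ ger0_norm; last first.
  by rewrite subr_ge0 ler_pdivrMr // mul1r ltW.
rewrite mulrBl mul1r divfK ?gt_eqF //.
by apply/esym/max_idPr; lra.
Qed.

Lemma excess_lipschitz r u v : `|excess r u - excess r v| <= `|u - v|.
Proof.
have h : `| `|u| - `|v| | <= `|u - v| by apply: ler_dist_dist.
move: h; rewrite !ler_norml /excess => /andP[h1 h2].
have [?|?] := leP (`|u| - r) 0; have [?|?] := leP (`|v| - r) 0;
  have : 0 <= `|u - v| by [].
all: by move=> ?; apply/andP; split; lra.
Qed.

Variables (infX : infinite_dimensional X) (ip : {dot H for idfun}).
Hypothesis ipn : forall x, ip x x = `|x| ^+ 2.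
Variables (f : X -> H) (L del : R).
Hypotheses (L0 : 0 < L) (del0 : 0 < del).
Hypothesis fL : forall x y, `|x| <= 1 -> `|y| <= 1 ->
  `|f x - f y| <= L * `|x - y|.
Hypothesis fdel : forall x y, `|x| <= 1 -> `|y| <= 1 ->
  8^-1 <= `|x - y| -> del <= `|f x - f y|.

(** The two cases of the reduction to the unit ball are distinguished by the total
    excess of the points over the radius; the Lipschitz constant is [8] in the
    first one and [1088 L / del] in the second. *)
Lemma average_embedding (s : seq X) (k : nat) : (0 < k)%N ->
  24 * ln (2 * (size s)%:R ^+ 2) <= k%:R :> R ->
  exists (w : 'I_k -> X) (g : X -> X),
  [/\ forall x, span_of w (g x),
      {in s &, forall x y, `|g x - g y| <= (8 + 1088 * L / del) * `|x - y|} &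
      \sum_(x <- s) \sum_(y <- s) `|x - y| <=
      \sum_(x <- s) \sum_(y <- s) `|g x - g y| ].
Proof.
move=> k0 ks; set a := 8 + _; set N := \sum_(x <- s) _.
have a0 : 0 <= 1088 * L / del.
  exact: (divr_ge0 (mulr_ge0 (ler0n _ _) (ltW L0)) (ltW del0)).
have N0 : 0 <= N by apply: sumr_ge0 => x _; apply: sumr_ge0.
have [Nz|Nn] := eqVneq N 0.
  exists (fun=> 0), (fun=> 0); split.
  - by move=> x; have := span_of_const (0 : X) 0 k0; rewrite scale0r.
  - by move=> x y _ _; rewrite subrr normr0 mulr_ge0 // /a; lra.
  - by rewrite Nz; apply: sumr_ge0 => x _; apply: sumr_ge0.
have {Nn}N0 : 0 < N by rewrite lt_def Nn.
have s0 : s != [::] by apply: contraTneq N0 => s0; rewrite /N s0 big_nil ltxx.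
pose n : R := (size s)%:R.
have n0 : 0 < n by rewrite ltr0n lt0n size_eq0.
have [p ps pmin] := exists_le_mean (fun x => \sum_(y <- s) `|x - y|) s0.
set T := \sum_(y <- s) `|p - y| in pmin; rewrite -/n -/N in pmin.
(* N is n^2 times the average distance, hence r is twice that average *)
pose r := 2 * N / n ^+ 2.
have r0 : 0 < r by rewrite divr_gt0 ?mulr_gt0 ?exprn_gt0.
have rn : r * n ^+ 2 = 2 * N by rewrite divfK // gt_eqF // exprn_gt0.
pose e x := excess r (x - p); pose E := \sum_(x <- s) e x.
have e0 x : 0 <= e x by rewrite /e /excess le_max lexx.
have E0 : 0 <= E by apply: sumr_ge0.
have eL x y : `|e x - e y| <= `|x - y|.
  apply: (le_trans (excess_lipschitz _ _ _)).
  by rewrite opprB addrA subrK.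
have [big_excess|small_excess] := leP (N / 4) (n * E).
  (* far points carry a fixed proportion of the distances: one dimension,
     namely the function e, suffices *)
  have [v0 /eqP v00] : exists v : X, v <> 0.
    have [b ib] := exists_lin_indep infX 1.
    exists (b ord0) => b0; have := ib (fun=> 1) _ ord0.
    by rewrite big_ord1 b0 scaler0 => /(_ erefl) /eqP; rewrite oner_eq0.
  pose v := `|v0|^-1 *: v0.
  have v1 : `|v| = 1 by rewrite normrZ normfV normr_id mulVf // normr_eq0.
  have gE x y : `|(8 * e x) *: v - (8 * e y) *: v| = 8 * `|e x - e y|.
    by rewrite -scalerBl normrZ v1 mulr1 -mulrBr normrM ger0_norm.
  exists (fun=> v), (fun x => (8 * e x) *: v); split.
  - by move=> x; apply: span_of_const.
  - move=> x y _ _; rewrite gE /a mulrDl.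
    by have := eL x y; have := mulr_ge0 a0 (normr_ge0 (x - y)); lra.
  - (* Markov's inequality in integrated form: the last factor is at most 1, and
       nonpositive when y is far from p *)
    have far x y : e x * (1 - `|p - y| / r) <= `|e x - e y|.
      have [h|h] := leP `|p - y| r.
        have ey : e y = 0 by rewrite /e /excess distrC; apply/max_idPl; lra.
        have h0 : 0 <= `|p - y| / r by rewrite divr_ge0 // ltW.
        rewrite ey subr0 ger0_norm //; have := e0 x; nra.
      have h1 : 1 <= `|p - y| / r by rewrite ler_pdivlMr // mul1r ltW.
      apply: le_trans (normr_ge0 _); have := e0 x; nra.
    apply: (@le_trans _ _ (8 * \sum_(x <- s) \sum_(y <- s) `|e x - e y|)); last first.
      rewrite mulr_sumr; apply: ler_sum => x _; rewrite mulr_sumr.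
      by apply: ler_sum => y _; rewrite gE.
    have : \sum_(x <- s) \sum_(y <- s) e x * (1 - `|p - y| / r) <=
           \sum_(x <- s) \sum_(y <- s) `|e x - e y|.
      by apply: ler_sum => x _; apply: ler_sum => y _; apply: far.
    have -> : \sum_(x <- s) \sum_(y <- s) e x * (1 - `|p - y| / r) = E * (n - T / r).
      rewrite mulr_suml; apply: eq_bigr => x _; rewrite -mulr_sumr; congr (_ * _).
      by rewrite sumrB sum_cst_seq mulr1 -mulr_suml.
    have Tr : T / r <= n / 2.
      by rewrite ler_pdivrMr //; nra.
    by nra.
(* most of the distances survive the retraction of the points to a ball of
   radius r around p *)
pose u x := r^-1 *: retract r (x - p).
have u1 x : `|u x| <= 1.
  by rewrite normrZ normfV (gtr0_norm r0) ler_pdivrMl // mulr1 norm_retract_le // ltW.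
have uL x y : `|u x - u y| <= 2 / r * `|x - y|.
  rewrite -scalerBr normrZ normfV (gtr0_norm r0) (mulrC 2) -mulrA.
  apply: ler_wpM2l; first by rewrite invr_ge0 ltW.
  apply: (le_trans (retract_lipschitz _ _ (ltW r0))).
  by rewrite opprB addrA subrK.
have ulow x y : r^-1 * (`|x - y| - e x - e y) <= `|u x - u y|.
  rewrite -scalerBr normrZ normfV (gtr0_norm r0); apply: ler_wpM2l.
    by rewrite invr_ge0 ltW.
  have ex := norm_sub_retract (x - p) (ltW r0); have ey := norm_sub_retract (y - p) (ltW r0).
  rewrite /e -ex -ey; set qx := retract _ _; set qy := retract _ _.
  have -> : x - y = (x - p - qx) + (qx - qy) - (y - p - qy).
    by rewrite (addrA (x - p - qx)) subrK opprB addrA subrK opprB addrA subrK.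
  have := ler_normB (x - p - qx + (qx - qy)) (y - p - qy).
  by have := ler_normD (x - p - qx) (qx - qy); lra.
pose U := \sum_(x <- s) \sum_(y <- s) `|u x - u y|.
have Ulow : n ^+ 2 / 4 <= U.
  have : \sum_(x <- s) \sum_(y <- s) r^-1 * (`|x - y| - e x - e y) <= U.
    by apply: ler_sum => x _; apply: ler_sum => y _; apply: ulow.
  have -> : \sum_(x <- s) \sum_(y <- s) r^-1 * (`|x - y| - e x - e y) =
            r^-1 * (N - n * E - n * E).
    under eq_bigr do rewrite -mulr_sumr; rewrite -mulr_sumr; congr (_ * _).
    under eq_bigr do rewrite !sumrB sum_cst_seq.
    by rewrite !sumrB -mulr_sumr sum_cst_seq.
  rewrite ler_pdivrMl // => h; rewrite -(ler_pM2l r0).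
  by lra.
(* affine in the distance, so that it can be summed over all pairs *)
have fu x y : del / 2 * (`|u x - u y| - 8^-1) <= `|f (u x) - f (u y)|.
  have u2 : `|u x - u y| <= 2.
    by rewrite (le_trans (ler_normB _ _)) //; have := u1 x; have := u1 y; lra.
  have [h|h] := leP 8^-1 `|u x - u y|.
    apply: le_trans (fdel (u1 x) (u1 y) h).
    rewrite -mulrA -[leRHS]mulr1; apply: ler_wpM2l; first exact: ltW.
    by lra.
  apply: le_trans (normr_ge0 _).
  by rewrite pmulr_rle0 ?divr_gt0 // subr_le0 ltW.
pose P := \sum_(x <- s) \sum_(y <- s) `|f (u x) - f (u y)|.
have Plow : del * n ^+ 2 / 16 <= P.
  have : \sum_(x <- s) \sum_(y <- s) del / 2 * (`|u x - u y| - 8^-1) <= P.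
    by apply: ler_sum => x _; apply: ler_sum => y _; apply: fu.
  have -> : \sum_(x <- s) \sum_(y <- s) del / 2 * (`|u x - u y| - 8^-1) =
            del / 2 * (U - n ^+ 2 / 8).
    under eq_bigr do rewrite -mulr_sumr; rewrite -mulr_sumr; congr (_ * _).
    under eq_bigr do rewrite sumrB sum_cst_seq.
    by rewrite sumrB sum_cst_seq -/n mulrA expr2.
  by have := ler_wpM2l (ltW del0) Ulow; lra.
have [|w [h [wh hs]]] := @hilbert_into_span R X H ip (map (f \o u) s) k infX ipn k0.
  by rewrite size_map.
(* 272 = 8 * 34 makes up for the distortion 34 of [h] and for [Plow], where
   [r n^2 = 2 N] *)
pose c := 272 / del * r.
have c0 : 0 < c by rewrite mulr_gt0 // divr_gt0.
have gE x y : `|c *: h (f (u x)) - c *: h (f (u y))| = c * `|h (f (u x)) - h (f (u y))|.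
  by rewrite -scalerBr normrZ gtr0_norm.
have hsu x y : x \in s -> y \in s ->
    `|f (u x) - f (u y)| / 34 <= `|h (f (u x)) - h (f (u y))| <=
    2 * `|f (u x) - f (u y)|.
  by move=> xs ys; apply: hs; apply: (map_f (f \o u)).
exists w, (fun x => c *: h (f (u x))); split.
- by move=> x; apply: span_ofZ.
- move=> x y xs ys; rewrite gE.
  have /andP[_ h1] := hsu x y xs ys; have h2 := fL (u1 x) (u1 y).
  apply: (@le_trans _ _ (c * (2 * (L * (2 / r * `|x - y|))))).
    apply: ler_wpM2l; first exact: ltW.
    have h3 := ler_wpM2l (ltW L0) (uL x y); lra.
  have -> : c * (2 * (L * (2 / r * `|x - y|))) = 1088 * L / del * `|x - y|.
    by rewrite /c; field; rewrite !gt_eqF.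
  by apply: ler_wpM2r => //; rewrite /a lerDr.
- apply: (@le_trans _ _ (c / 34 * P)).
    have -> : N = c / 34 * (del * n ^+ 2 / 16).
      rewrite [RHS](_ : _ = r * n ^+ 2 / 2); last by rewrite /c; field; rewrite gt_eqF.
      by rewrite rn; field.
    by apply: ler_wpM2l => //; rewrite divr_ge0 // ltW.
  rewrite mulr_sumr; apply: ler_sum_mem => x xs; rewrite mulr_sumr.
  apply: ler_sum_mem => y ys; rewrite gE.
  by have /andP[h1 _] := hsu x y xs ys; have := ler_wpM2l (ltW c0) h1; lra.
Qed.
End AverageEmbedding.

(** * The dimension of the target *)

(** A logarithm rounded to an integer; 72 = 24 * 3 since [2 n^2] is at most
    [8^(trunc_log 2 n + 1)] and [ln 2 <= 1]. *)
Definition target_dim (n : nat) : nat := 72 * (trunc_log 2 n).+1.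

Section TargetDimension.
Context {R : realType}.

Lemma target_dim_ge (n : nat) : (0 < n)%N ->
  24 * ln (2 * n%:R ^+ 2) <= (target_dim n)%:R :> R.
Proof.
move=> n0; rewrite /target_dim; set t := trunc_log 2 n.
have nt : (n < 2 ^ t.+1)%N by apply: trunc_log_ltn.
have ntR : n%:R <= 2 ^+ t.+1 :> R by rewrite -natrX ler_nat ltnW.
have np : 0 < n%:R :> R by rewrite ltr0n.
have : ln (2 * n%:R ^+ 2) <= ln (2 ^+ (2 * t + 3)) :> R.
  rewrite ler_ln ?posrE ?mulr_gt0 ?exprn_gt0 //.
  have -> : 2 ^+ (2 * t + 3) = 2 * (2 ^+ t.+1) ^+ 2 :> R.
    by rewrite -exprM -exprS; congr (_ ^+ _); lia.
  by rewrite ler_pM2l // lerXn2r ?nnegrE ?exprn_ge0 // ltW.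
rewrite lnXn // -(mulr_natr (ln 2)) natrD natrM.
have /andP[_ l2] := ln2_bounds R.
have t0 : 0 <= t%:R :> R by [].
by rewrite natrM -natr1; nra.
Qed.

Lemma target_dim_le (n : nat) : (1 < n)%N ->
  (target_dim n)%:R <= 288 * ln n%:R :> R.
Proof.
move=> n1; rewrite /target_dim; set t := trunc_log 2 n.
have t1 : (0 < t)%N by rewrite trunc_log_gt0.
have nt : (2 ^ t <= n)%N by apply: trunc_logP => //; apply: ltnW.
have : ln (2 ^+ t) <= ln n%:R :> R.
  by rewrite ler_ln ?posrE ?exprn_gt0 ?ltr0n ?(ltnW n1) // -natrX ler_nat.
rewrite lnXn // -(mulr_natr (ln 2)).
have /andP[l2 _] := ln2_bounds R.
have t0 : 1 <= t%:R :> R by rewrite ler1n.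
by rewrite natrM -natr1; nra.
Qed.

Lemma target_dim_subpolynomial :
  (fun n => ln (target_dim n)%:R / ln n%:R : R) @ \oo --> (0 : R).
Proof.
apply/cvgrPdist_le => eps eps0.
have [K hK] : exists K : nat, 1152 / eps ^+ 2 <= K%:R :> R.
  exists (Num.trunc (1152 / eps ^+ 2 : R)).+1.
  by apply: ltW; apply: truncnS_gt.
near=> n.
have n1 : (1 < n)%N by near: n; exists 2%N.
have nK : (2 ^ (2 * K).+1 <= n)%N by near: n; exists (2 ^ (2 * K).+1)%N.
set k := (target_dim n)%:R; set l := ln n%:R.
have kl : k <= 288 * l := target_dim_le n1.
have k1 : 1 <= k by rewrite ler1n /target_dim.
have kp : 0 < k by lra.
have l0 : 0 < l by apply: ln_gt0; rewrite ltr1n.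
have Kl : K%:R <= l.
  have : ln ((2 ^ (2 * K).+1)%:R : R) <= l.
    by rewrite ler_ln ?posrE ?ltr0n ?expn_gt0 ?ler_nat // ltnW.
  rewrite natrX lnXn // -(mulr_natr (ln 2)) -(natr1 (2 * K)) natrM.
  have /andP[l2 _] := ln2_bounds R.
  by have : 0 <= K%:R :> R by []; nra.
rewrite sub0r normrN ger0_norm; last exact: divr_ge0 (ln_ge0 k1) (ltW l0).
rewrite ler_pdivrMr //.
(* a square root grows slowly enough, as [k] is at most a multiple of [l] *)
have : ln k <= 2 * Num.sqrt k.
  have -> : ln k = 2 * ln (Num.sqrt k).
    by rewrite -[in LHS](sqr_sqrtr (ltW kp)) lnXn ?sqrtr_gt0 // mulr_natl.
  rewrite ler_pM2l //.
  by apply: ltW; apply: ln_sublinear; rewrite sqrtr_gt0.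
move=> /le_trans; apply.
rewrite -ler_sqr ?nnegrE ?mulr_ge0 ?sqrtr_ge0 ?(ltW l0) ?(ltW eps0) //.
rewrite !exprMn sqr_sqrtr ?(ltW kp) //.
have e2 : 0 < eps ^+ 2 by rewrite exprn_gt0.
move: hK; rewrite ler_pdivrMr // => hK.
have : 1152 <= l * eps ^+ 2 by apply: le_trans hK _; rewrite ler_pM2r.
by nra.
Unshelve. all: by end_near.
Qed.
End TargetDimension.

Lemma average_embeds_of_span {R : realType} {X : normedModType R}
    (a : R) (A : {fset X}) d (w : 'I_d -> X) (F : set X) :
  span_of w `<=` F ->
  (exists g : X -> X, [/\ forall x, span_of w (g x),
      {in A &, forall x y, `|g x - g y| <= a * `|x - y|} &
      \sum_(x <- A) \sum_(y <- A) `|x - y| <=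
      \sum_(x <- A) \sum_(y <- A) `|g x - g y| ]) ->
  average_embeds a A F.
Proof.
move=> wF [g [gw gL gA]]; exists g; split.
- by move=> x _; apply/wF/gw.
- by move=> x y xA yA; apply: gL.
- by apply: ler_wpM2l => //; rewrite invr_ge0 exprn_ge0.
Qed.

Theorem theorem25 (R : realType) :
  exists C : R, 0 < C /\
  forall X : completeNormedModType R,
    infinite_dimensional X ->
    (exists (H : completeNormedModType R) (f : X -> H),
      [/\ is_hilbert H,
          {in unit_ball X &, injective f},
          [lipschitz f x | x in unit_ball X] &
          unif_continuous
            (pinv (unit_ball X) f : subspace (f @` unit_ball X) -> X)]) ->
    average_metric_dimension_reduction X /\
    exists alpha : R, 1 <= alpha /\
      forall (n : nat) (A : {fset X}), (0 < n)%N -> #|` A| = n ->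
        exists (F : set X) (d : nat),
          [/\ subspace_of_dim F d, d%:R <= C * ln n%:R &
              average_embeds alpha A F].
Proof.
exists 288; split => // X infX [H [f [[ip ipn] fI fLip fU]]].
have [L L0 fL] := lipschitz_bound fLip.
have [del del0 fdel] : exists2 del : R, 0 < del & forall x y,
    `|x| <= 1 -> `|y| <= 1 -> 8^-1 <= `|x - y| -> del <= `|f x - f y|.
  by apply: inverse_modulus => //; rewrite invr_gt0.
pose a := 8 + 1088 * L / del.
have a1 : 1 <= a.
  have := divr_ge0 (mulr_ge0 (ler0n R 1088) (ltW L0)) (ltW del0).
  by rewrite /a; lra.
have main (n : nat) (A : {fset X}) : (0 < n)%N -> #|` A| = n ->
    exists F : set X, subspace_of_dim F (target_dim n) /\ average_embeds a A F.
  move=> n0 An; have k0 : (0 < target_dim n)%N by [].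
  have [|w [g gP]] := average_embedding infX ipn L0 del0 fL fdel (s := A) k0.
    by rewrite An target_dim_ge.
  have [b ib wb] := span_sub_lin_indep infX w.
  exists (span_of b); split; first by exists b.
  by apply: (average_embeds_of_span wb); exists g.
split.
  by exists a, target_dim; split => //; apply: target_dim_subpolynomial.
exists a; split => // n A n0 An.
(* for one point, [ln 1 = 0] leaves only the zero subspace *)
have [n1|n1] := leqP n 1; last first.
  have [F [dF eF]] := main n A n0 An.
  by exists F, (target_dim n); split => //; apply: target_dim_le.
have {n1}n1 : n = 1%N by apply/eqP; rewrite eqn_leq n1.
pose b (i : 'I_0) : X := 0.
exists (span_of b), 0%N; split.
- by exists b; split => // c _ [].
- by rewrite n1 ln1 mulr0.
- apply: (average_embeds_of_span (w := b)) => //; exists (fun=> 0); split.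
  + by move=> x; exists (fun=> 0) => //; rewrite big_ord0.
  + by move=> x y _ _; rewrite subrr normr0 mulr_ge0 //; lra.
  + have [x xA] : exists x, enum_fset A = [:: x].
      by move: An; rewrite n1; case: (enum_fset A) => [|x []] //; exists x.
    by rewrite xA !big_seq1 !subrr.
Qed.
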